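(* Let $p$ be an odd prime and $n$ a positive integer, and let $G=ES_2(p,n)$ be the extra-special $p$-group of order $p^{2n+1}$ and exponent $p^2$. Let $x_1=(1,\underline{0}^{n-1},0,\underline{0}^{n-1})$, $y_1=(0,\underline{0}^{n-1},1,\underline{0}^{n-1})$, and for $2\le i\le n$ let $x_i=(0,e^{n-1}_{i-1},0,\underline{0}^{n-1})$, $y_i=(0,\underline{0}^{n-1},0,e^{n-1}_{i-1})$. Then: (A) If $\sigma\in End(G)$, then the induced endomorphism $\overline{\sigma}$ of $G/\mathcal{Z}(G)$ satisfies $\langle\langle\overline{\sigma}(\overline{x}),\overline{\sigma}(\overline{y})\rangle\rangle=l\,\langle\langle\overline{x},\overline{y}\rangle\rangle$ for all $x,y\in G$, where $l\in\mathbb{F}_p$ is given by $\sigma(z)=z^l$ for any generator $z$ of $\mathcal{Z}(G)$. Moreover: (a) $\sigma(x_1)$ can be any element of $G$; (b) $\sigma(x_i),\sigma(y_j)\in H$ for $2\le i\le n$, $1\le j\le n$. (B) For every $\sigma\in End(G)$, writing the matrix of $\overline{\sigma}$ with respect to the ordered basis $\{\overline{x}_1,\ldots,\overline{x}_n,\overline{y}_1,\ldots,\overline{y}_n\}$ of $G/\mathcal{Z}(G)=\mathbb{F}_p^{2n}$ in $n\times n$ blocks $A=[a_{ij}]$, $B=[b_{ij}]$, $C=[c_{ij}]$, $D=[d_{ij}]$, one has $$(1)\qquad\overline{\sigma}=\begin{pmatrix}A&C\\ D&B\end{pmatrix}\in symp^{scalar}(2n,\mathbb{F}_p)$$ (possibly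 non-invertible), and $$(2)\qquad\begin{aligned}&\overline{\sigma}^t\Delta\overline{\sigma}=a_{11}\Delta\ (a_{11}\text{ can be zero}),\quad a_{12}=a_{13}=\cdots=a_{1n}=0,\quad c_{11}=c_{12}=\cdots=c_{1n}=0,\\&\sigma(u_1,\underline{u},w_1,\underline{w})=(au_1+i_{21}(s),\,\pi(A\widetilde{\underline{u}}+C\widetilde{\underline{w}}),\,D\widetilde{\underline{u}}+B\widetilde{\underline{w}})\end{aligned}$$ for all $(u_1,\underline{u},w_1,\underline{w})\in G$, where $$(3)\qquad\begin{aligned}&a\in\mathbb{Z}/p^2\mathbb{Z},\quad a\equiv a_{11}\bmod p\ (\text{can be zero}),\\&s=\alpha(\underline{u})+\beta(\widetilde{\underline{w}})+\tfrac12\widetilde{\underline{u}}^t(A^tD)\widetilde{\underline{u}}+\tfrac12\widetilde{\underline{w}}^t(C^tB)\widetilde{\underline{w}}+\widetilde{\underline{w}}^t(C^tD)\widetilde{\underline{u}}\end{aligned}$$ for some $\alpha\in((\mathbb{Z}/p\mathbb{Z})^{n-1})^{\vee}$, $\beta\in((\mathbb{Z}/p\mathbb{Z})^n)^{\vee}$. Conversely, if $\sigma$ is given as in (1), (2), (3), then $\sigma\in End(G)$. (C) If $\sigma\in Aut(G)$, then the induced automorphism $\overline{\sigma}$ of $G/\mathcal{Z}(G)$ satisfies $\langle\langle\overline{\sigma}(\overline{x}),\overline{\sigma}(\overline{y})\rangle\rangle=l\,\langle\langle\overline{x},\overline{y}\rangle\rangle$ for all $x,y\in G$, where $l\in\mathbb{F}_p^{*}$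 is given by $\sigma(z)=z^l$ for any generator $z$ of $\mathcal{Z}(G)$. Moreover: (a) $\sigma(x_1)=x_1^lg$ for some $g\in H$; (b) $\sigma(y_1)=y_1h$ for some $h\in\mathcal{Z}(G)$; (c) $\sigma(x_i),\sigma(y_i)\in H\setminus K$ for $2\le i\le n$. (D) Every $\sigma\in Aut(G)$ has the expression (1), (2), (3), where in addition $\overline{\sigma}\in Sp^{scalar}(2n,\mathbb{F}_p)$, $a_{11}\in\mathbb{F}_p^{*}$ (that is, $a_{11}\not\equiv0\bmod p$) and $a\in(\mathbb{Z}/p^2\mathbb{Z})^{*}$. Conversely, if $\sigma$ is given by (1), (2), (3) with these additional conditions, then $\sigma\in Aut(G)$. As a consequence, for $\sigma\in Aut(G)$ one has in addition: (a) $b_{11}=1$; (b) $b_{21}=b_{31}=\cdots=b_{n1}=c_{21}=c_{31}=\cdots=c_{n1}=0$. (E) For $g\in G$ the set of endomorphism semigroup images $\{\sigma(g)\mid\sigma\in End(G)\}$ is: (a) $\{e\}$ if $g=e$, of cardinality $1$; (b) $\mathcal{Z}(G)$ if $g\in\mathcal{Z}(G)\setminus\{e\}$, of cardinality $p$; (c) $H$ if $g\in H\setminus\mathcal{Z}(G)$, of cardinality $p^{2n}$; (d) $G$ if $g\in G\setminus H$, of cardinality $p^{2n+1}$. (F) There are $p+2$ automorphism orbits in $G$ if $n=1$ and $p+3$ if $n>1$. They are: (a) $\{e\}$, of cardinality $1$; (b) $\mathcal{Z}(G)\setminus\{e\}$, of cardinality $p-1$; (c) for each $b\in(\mathbb{Z}/p\mathbb{Z})^{*}$,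 $\mathcal{O}_b=p(\mathbb{Z}/p^2\mathbb{Z})\times\{\underline{0}^{n-1}\}\times\{b\}\times\{\underline{0}^{n-1}\}$, of cardinality $p$; (d) $G\setminus H$, that is, all elements of order $p^2$, of cardinality $p^{2n+1}-p^{2n}$; (e) if $n>1$, one more orbit $H\setminus K$, of cardinality $p^{2n}-p^2$. (G) In $G$ there exist two elements which are endomorphic to each other but are not automorphic. The endomorphism semigroup does not induce a partial order on the automorphism orbits. In particular the set $H\setminus\mathcal{Z}(G)=\bigsqcup_{b\in(\mathbb{Z}/p\mathbb{Z})^{*}}\mathcal{O}_b\ \sqcup\ (H\setminus K)$ is a disjoint union of $p$ automorphism orbits.
   Context: $\mathbb{F}_p=\mathbb{Z}/p\mathbb{Z}$; $^t$ denotes transpose; $V^{\vee}$ is the dual space; $e_i^{m}\in\mathbb{F}_p^{m}$ is the $i$-th standard basis (column) vector and $\underline{0}^{m}$ the zero vector; $e$ is the identity of $G$. Let $i_{21}:\mathbb{Z}/p\mathbb{Z}\hookrightarrow\mathbb{Z}/p^2\mathbb{Z}$ be the inclusion of abelian groups $a\mapsto pa$. For $\underline{u}=(u_2,\ldots,u_n)^t,\underline{w}=(w_2,\ldots,w_n)^t\in(\mathbb{Z}/p\mathbb{Z})^{n-1}$, $\langle\underline{u},\underline{w}\rangle=\sum_{i=2}^nu_iw_i\in\mathbb{Z}/p\mathbb{Z}$. $ES_2(p,n)$ is the set $\mathbb{Z}/p^2\mathbb{Z}\oplus(\mathbb{Z}/p\mathbb{Z})^{n-1}\oplus\mathbb{Z}/p\mathbb{Z}\oplus(\mathbb{Z}/p\mathbb{Z})^{n-1}$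 with group operation $(u^1_1,\underline{u}^1,w^1_1,\underline{w}^1).(u^2_1,\underline{u}^2,w^2_1,\underline{w}^2)=\big(u^1_1+u^2_1+i_{21}(w^2_1)u^1_1+i_{21}(\langle\underline{u}^1,\underline{w}^2\rangle),\ \underline{u}^1+\underline{u}^2,\ w^1_1+w^2_1,\ \underline{w}^1+\underline{w}^2\big)$. For $G=ES_2(p,n)$: $\mathcal{Z}(G)=p(\mathbb{Z}/p^2\mathbb{Z})\oplus\{\underline{0}^{n-1}\}\oplus\{0\}\oplus\{\underline{0}^{n-1}\}$ is the center (equal to the commutator subgroup, of order $p$); $H=p(\mathbb{Z}/p^2\mathbb{Z})\oplus(\mathbb{Z}/p\mathbb{Z})^{n-1}\oplus\mathbb{Z}/p\mathbb{Z}\oplus(\mathbb{Z}/p\mathbb{Z})^{n-1}$; $K=p(\mathbb{Z}/p^2\mathbb{Z})\oplus\{\underline{0}^{n-1}\}\oplus\mathbb{Z}/p\mathbb{Z}\oplus\{\underline{0}^{n-1}\}=\mathcal{Z}(H)$. The quotient $G/\mathcal{Z}(G)$ is identified with $\mathbb{F}_p^{2n}$. For $u_1\in\mathbb{Z}/p^2\mathbb{Z}$, $\overline{u}_1\in\mathbb{Z}/p\mathbb{Z}$ is its reduction mod $p$. For $(u_1,\underline{u},w_1,\underline{w})\in G$, $\widetilde{\underline{u}}=\begin{pmatrix}\overline{u}_1\\\underline{u}\end{pmatrix}$ and $\widetilde{\underline{w}}=\begin{pmatrix}w_1\\\underline{w}\end{pmatrix}$ in $(\mathbb{Z}/p\mathbb{Z})^n$.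 $\pi:\mathbb{Z}/p\mathbb{Z}\oplus(\mathbb{Z}/p\mathbb{Z})^{n-1}\to(\mathbb{Z}/p\mathbb{Z})^{n-1}$ is the projection ignoring the first coordinate. A vector of $(\mathbb{Z}/p\mathbb{Z})^n$ in the last slot (such as $D\widetilde{\underline{u}}+B\widetilde{\underline{w}}$) is read as an element of the last two summands $\mathbb{Z}/p\mathbb{Z}\oplus(\mathbb{Z}/p\mathbb{Z})^{n-1}$ of $G$. Symplectic form: fix a generator $z$ of $\mathcal{Z}(G)$ and define $f:G\times G\to\mathbb{F}_p$ by $[x,y]=z^{f(x,y)}$; then $\langle\langle\overline{x},\overline{y}\rangle\rangle=f(x,y)$, where $\overline{x}=x\mathcal{Z}(G)$, is a non-degenerate symplectic form on $G/\mathcal{Z}(G)$. $End(G)$ is the semigroup of group endomorphisms of $G$, $Aut(G)$ its automorphism group; each $\sigma$ in $End(G)$ (resp. $Aut(G)$) induces an endomorphism (resp. automorphism) $\overline{\sigma}$ of $G/\mathcal{Z}(G)$. Let $\Delta=\begin{pmatrix}0_{n\times n}&I_{n\times n}\\-I_{n\times n}&0_{n\times n}\end{pmatrix}$. $symp^{scalar}(2n,\mathbb{F}_p)=\{N\in M_{2n}(\mathbb{F}_p)\mid N^t\Delta N=l\Delta\text{ for some }l\in\mathbb{F}_p\}$ and $Sp^{scalar}(2n,\mathbb{F}_p)=\{M\in GL_{2n}(\mathbb{F}_p)\mid M^t\Delta M=l\Delta\text{ for some }l\in\mathbb{F}_p^{*}\}$. For $x,y\in G$, $y$ is endomorphic to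 $x$ if $\sigma(x)=y$ for some $\sigma\in End(G)$, and automorphic to $x$ if $\sigma(x)=y$ for some $\sigma\in Aut(G)$. The endomorphism semigroup induces a partial order on the set of automorphism orbits if whenever $y$ is endomorphic to $x$ and $x$ is endomorphic to $y$, then $y$ is automorphic to $x$.
   Formalization: In the last sentence of (G), the count of p automorphism orbits in H∖Z(G) is proved for n>1; for n=1, where H=K and H∖K is empty, the count is corrected to p−1 (e.g. p=3, n=1 gives two orbits). *)

(* Defs.v *)
From HB Require Import structures.
From mathcomp Require Import all_boot all_order all_algebra.
From mathcomp Require Import all_fingroup all_solvable.
From mathcomp Require Import ring.

Set Implicit Arguments.
Unset Strict Implicit.
Unset Printing Implicit Defensive.

Import GRing.Theory.
Local Open Scope ring_scope.

Section Arithmetic.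

Variable p : nat.

Definition red (u : 'Z_(p ^ 2)) : 'F_p := (u : nat)%:R.

(* The inclusion a |-> p a of Z/p into Z/p^2. *)
Definition i21 (a : 'F_p) : 'Z_(p ^ 2) := (p * a)%:R.

Definition pZ : {set 'Z_(p ^ 2)} := [set p%:R * t | t : 'Z_(p ^ 2)].

Definition dot m (u w : 'cV['F_p]_m) : 'F_p := \sum_(i < m) u i 0 * w i 0.

End Arithmetic.

Section ArithmeticTheory.

Variables (p : nat) (hp : prime p).

Lemma p2_gt1 : (1 < p ^ 2)%N.
Proof. by rewrite -[1%N](exp1n 2) ltn_exp2r ?prime_gt1. Qed.

Lemma red_nat k : red (k%:R : 'Z_(p ^ 2)) = k%:R.
Proof.
rewrite /red val_Zp_nat ?p2_gt1 // -(Fp_nat_mod hp) modn_dvdm ?Fp_nat_mod //.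
by rewrite expnS dvdn_mulr.
Qed.

Lemma i21_nat k : i21 (k%:R : 'F_p) = (p * k)%:R.
Proof.
rewrite /i21 (val_Fp_nat hp); apply: val_inj.
by rewrite /= !val_Zp_nat ?p2_gt1 // -mulnn -!muln_modr modn_mod.
Qed.

Lemma redD : {morph @red p : x y / x + y}.
Proof. by move=> x y; rewrite -[x]natr_Zp -[y]natr_Zp -natrD !red_nat natrD. Qed.

Lemma redM : {morph @red p : x y / x * y}.
Proof. by move=> x y; rewrite -[x]natr_Zp -[y]natr_Zp -natrM !red_nat natrM. Qed.

Lemma red0 : red (0 : 'Z_(p ^ 2)) = 0.
Proof. exact: (red_nat 0). Qed.

Lemma red1 : red (1 : 'Z_(p ^ 2)) = 1.
Proof. exact: (red_nat 1). Qed.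

Lemma redN (x : 'Z_(p ^ 2)) : red (- x) = - red x.
Proof. by apply/eqP; rewrite -addr_eq0 -redD addNr red0. Qed.

Lemma i21D : {morph @i21 p : x y / x + y}.
Proof.
by move=> x y; rewrite -[x]natr_Zp -[y]natr_Zp -natrD !i21_nat mulnDr natrD.
Qed.

Lemma i21_0 : i21 (0 : 'F_p) = 0.
Proof. by rewrite (i21_nat 0) muln0. Qed.

Lemma i21N (x : 'F_p) : i21 (- x) = - i21 x.
Proof. by apply/eqP; rewrite -addr_eq0 -i21D addNr i21_0. Qed.

Lemma i21Mr (a : 'F_p) (x : 'Z_(p ^ 2)) : i21 a * x = i21 (a * red x).
Proof.
by rewrite -[a]natr_Zp -[x]natr_Zp red_nat -natrM !i21_nat mulnA -natrM.
Qed.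

Lemma red_i21 (a : 'F_p) : red (i21 a) = 0.
Proof.
by rewrite /i21 red_nat natrM (pchar_Fp_0 hp) mul0r.
Qed.

Lemma i21_inj : injective (@i21 p).
Proof.
move=> a b /(congr1 (@nat_of_ord _)); rewrite /i21 !val_Zp_nat ?p2_gt1 //.
have lt_p (c : 'F_p) : (c < p)%N by rewrite -[ltnRHS](Fp_cast hp) ltn_ord.
rewrite -mulnn -!muln_modr !modn_small // => /eqP.
by rewrite eqn_pmul2l ?prime_gt0 // => /eqP/val_inj.
Qed.

Lemma mem_pZ (x : 'Z_(p ^ 2)) : (x \in pZ p) = (red x == 0).
Proof.
apply/imsetP/eqP=> [[t _ ->]|].
  by rewrite redM red_nat (pchar_Fp_0 hp) mul0r.
move/(congr1 (@nat_of_ord _)); rewrite /red (val_Fp_nat hp) /= => /eqP/dvdnP[k Dx].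
by exists k%:R => //; rewrite -natrM mulnC -Dx natr_Zp.
Qed.

Lemma pZ_i21 (x : 'Z_(p ^ 2)) : x \in pZ p -> {a : 'F_p | x = i21 a}.
Proof.
rewrite mem_pZ => /eqP x0.
exists ((x %/ p)%N%:R); rewrite i21_nat mulnC divnK ?natr_Zp //.
by move/(congr1 (@nat_of_ord _)): x0; rewrite /red (val_Fp_nat hp) /= => /eqP.
Qed.

Lemma dotDl m (u v w : 'cV['F_p]_m) : dot (u + v) w = dot u w + dot v w.
Proof. by rewrite /dot -big_split; apply: eq_bigr => i _; rewrite mxE mulrDl. Qed.

Lemma dotDr m (u v w : 'cV['F_p]_m) : dot u (v + w) = dot u v + dot u w.
Proof. by rewrite /dot -big_split; apply: eq_bigr => i _; rewrite mxE mulrDr. Qed.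

Lemma dotNl m (u w : 'cV['F_p]_m) : dot (- u) w = - dot u w.
Proof. by rewrite /dot -sumrN; apply: eq_bigr => i _; rewrite mxE mulNr. Qed.

Lemma dot0l m (w : 'cV['F_p]_m) : dot 0 w = 0.
Proof. by rewrite /dot big1 // => i _; rewrite mxE mul0r. Qed.

Lemma dot0r m (u : 'cV['F_p]_m) : dot u 0 = 0.
Proof. by rewrite /dot big1 // => i _; rewrite mxE mulr0. Qed.

Lemma dot_deltal m (w : 'cV['F_p]_m) i : dot (delta_mx i 0) w = w i 0.
Proof.
rewrite /dot (bigD1 i) //= mxE !eqxx mul1r big1 ?addr0 // => j /negbTE nij.
by rewrite mxE nij mul0r.
Qed.

Lemma dot_deltar m (u : 'cV['F_p]_m) i : dot u (delta_mx i 0) = u i 0.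
Proof.
rewrite /dot (bigD1 i) //= mxE !eqxx mulr1 big1 ?addr0 // => j /negbTE nij.
by rewrite mxE nij mulr0.
Qed.

End ArithmeticTheory.

(* The underlying set of ES_2(p, n) for n = m.+1. The primality proof is a
   parameter because the operation below is a group law only for suitable p. *)
Record ES2 (p : nat) (hp : prime p) (m : nat) := MkES2 {
  eu1 : 'Z_(p ^ 2);
  eu : 'cV['F_p]_m;
  ew1 : 'F_p;
  ew : 'cV['F_p]_m }.

Section Group.

Variables (p : nat) (hp : prime p) (m : nat).
Notation G := (ES2 hp m).

Definition ES2_tuple (g : G) := (eu1 g, eu g, ew1 g, ew g).
Definition tuple_ES2 t : G := MkES2 hp t.1.1.1 t.1.1.2 t.1.2 t.2.
Lemma ES2_tupleK : cancel ES2_tuple tuple_ES2. Proof. by case. Qed.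

HB.instance Definition _ := Finite.copy G (can_type ES2_tupleK).

Definition ES2_mul (x y : G) : G :=
  MkES2 hp
    (eu1 x + eu1 y + i21 (ew1 y) * eu1 x + i21 (dot (eu x) (ew y)))
    (eu x + eu y) (ew1 x + ew1 y) (ew x + ew y).

Definition ES2_one : G := MkES2 hp 0 0 0 0.

Definition ES2_inv (x : G) : G :=
  MkES2 hp (- eu1 x + i21 (ew1 x) * eu1 x + i21 (dot (eu x) (ew x)))
    (- eu x) (- ew1 x) (- ew x).

Lemma ES2_mulA : associative ES2_mul.
Proof.
move=> [a b c d] [a' b' c' d'] [a2 b2 c2 d2]; rewrite /ES2_mul /=.
congr MkES2; rewrite ?addrA //.
rewrite !i21Mr // !redD // !red_i21 // !dotDl !dotDr !mulrDl !mulrDr.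
by rewrite mulr0 !(i21D hp) (i21_0 hp); ring.
Qed.

Lemma ES2_mul1 : left_id ES2_one ES2_mul.
Proof.
move=> [a b c d]; rewrite /ES2_mul /= !add0r mulr0 addr0 dot0l (i21_0 hp).
by rewrite addr0.
Qed.

Lemma ES2_mulV : left_inverse ES2_one ES2_inv ES2_mul.
Proof.
move=> [a b c d]; rewrite /ES2_mul /ES2_one /= !addNr; congr MkES2.
rewrite !i21Mr // !redD // redN // !red_i21 // !addr0 mulrN dotNl !(i21N hp).
by ring.
Qed.

HB.instance Definition _ := Finite_isGroup.Build G ES2_mulA ES2_mul1 ES2_mulV.

End Group.

Section Endomorphisms.

Variable gT : finGroupType.
Notation Z := ('Z([set: gT]))%g.

Definition Endo : {set {ffun gT -> gT}} :=
  [set s : {ffun gT -> gT} | morphic [set: gT] s].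

Definition end_images (x : gT) : {set gT} :=
  [set s x | s : {ffun gT -> gT} in Endo].

Definition endomorphic (y x : gT) : Prop := y \in end_images x.

Definition aut_orbit (x : gT) : {set gT} := orbit 'P (Aut [set: gT]) x.

Definition automorphic (y x : gT) : Prop := y \in aut_orbit x.

Definition aut_orbits : {set {set gT}} := aut_orbit @: [set: gT].

Definition End_induces_order : Prop :=
  forall x y : gT, endomorphic y x -> endomorphic x y -> automorphic y x.

(* Meaningful for maps s sending each coset of the centre into a coset of the
   centre, in particular for endomorphisms of ES2 (induced_coset below). *)
Definition induced (s : gT -> gT) (q : coset_of Z) : coset_of Z :=
  coset Z (s (repr q)).

(* The exponent k with [x, y] = z ^ k, for representatives x of q1 and y of
   q2; z is meant to be a generator of a centre of order p containing the
   commutators (symp_formP below). *)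
Definition symp_form (p : nat) (z : gT) (q1 q2 : coset_of Z) : 'F_p :=
  odflt 0 [pick k : 'F_p | [~ repr q1, repr q2]%g == (z ^+ k)%g].

End Endomorphisms.

Section Subsets.

Variables (p : nat) (hp : prime p) (m : nat).
Notation G := (ES2 hp m).

Definition ES2_H : {set G} := [set g : G | eu1 g \in pZ p].

Definition ES2_K : {set G} :=
  [set g : G | [&& eu1 g \in pZ p, eu g == 0 & ew g == 0]].

Definition ES2_O (b : 'F_p) : {set G} :=
  [set g : G | [&& eu1 g \in pZ p, eu g == 0, ew1 g == b & ew g == 0]].

(* xgen i and ygen i are the generators x_(i+1) and y_(i+1) of the usual list
   x_1, ..., x_n, y_1, ..., y_n. *)
Definition xgen (i : 'I_m.+1) : G :=
  if unlift ord0 i is Some k then MkES2 hp 0 (delta_mx k 0) 0 0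
  else MkES2 hp 1 0 0 0.

Definition ygen (i : 'I_m.+1) : G :=
  if unlift ord0 i is Some k then MkES2 hp 0 0 0 (delta_mx k 0)
  else MkES2 hp 0 0 1 0.

Definition utilde (g : G) : 'cV['F_p]_(1 + m) :=
  col_mx (const_mx (red (eu1 g))) (eu g).

Definition wtilde (g : G) : 'cV['F_p]_(1 + m) :=
  col_mx (const_mx (ew1 g)) (ew g).

Notation Z := ('Z([set: G]))%g.

(* The identification of G / Z(G) with F_p^(2n); coordq_coset below shows that it
   does not depend on the representative. *)
Definition coordq (q : coset_of Z) : 'cV['F_p]_(m.+1 + m.+1) :=
  col_mx (utilde (repr q)) (wtilde (repr q)).

Definition basisq (j : 'I_(m.+1 + m.+1)) : coset_of Z :=
  match split j with inl i => coset Z (xgen i) | inr i => coset Z (ygen i) end.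

Definition mx_of (f : coset_of Z -> coset_of Z) : 'M['F_p]_(m.+1 + m.+1) :=
  \matrix_(i, j) coordq (f (basisq j)) i 0.

End Subsets.

Section SympScalar.

Variables (F : finFieldType) (n : nat).

Definition Delta : 'M[F]_(n + n) := block_mx 0 1%:M (- 1%:M) 0.

Definition symp_scalar : {set 'M[F]_(n + n)} :=
  [set N : 'M[F]_(n + n) |
    [exists l : F, N^T *m Delta *m N == l *: Delta]].

Definition Sp_scalar : {set 'M[F]_(n + n)} :=
  [set N : 'M[F]_(n + n) | (N \in unitmx) &&
    [exists l : F, (l != 0) && (N^T *m Delta *m N == l *: Delta)]].

End SympScalar.

Section Expression.

Variables (p : nat) (hp : prime p) (m : nat).
Notation G := (ES2 hp m).

Variables (A B C D : 'M['F_p]_m.+1) (a : 'Z_(p ^ 2)).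
Variables (alpha : {scalar 'cV['F_p]_m}) (beta : {scalar 'cV['F_p]_m.+1}).

Definition endo_s (g : G) : 'F_p :=
  let u := utilde g in let w := wtilde g in
  alpha (eu g) + beta w
  + 2%:R^-1 * (u^T *m (A^T *m D) *m u) 0 0
  + 2%:R^-1 * (w^T *m (C^T *m B) *m w) 0 0
  + (w^T *m (C^T *m D) *m u) 0 0.

Definition endo_map (g : G) : G :=
  let u := utilde g in let w := wtilde g in
  let v : 'cV['F_p]_(1 + m) := A *m u + C *m w in
  let v' : 'cV['F_p]_(1 + m) := D *m u + B *m w in
  MkES2 hp (a * eu1 g + i21 (endo_s g))
    (dsubmx v) (usubmx v' 0 0) (dsubmx v').

Definition endo_expr (s : G -> G) : Prop :=
  let S := block_mx A C D B in
  [/\ S \in symp_scalar 'F_p m.+1,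
      S^T *m Delta 'F_p m.+1 *m S = A ord0 ord0 *: Delta 'F_p m.+1,
      (forall j, j != ord0 -> A ord0 j = 0) /\ (forall j, C ord0 j = 0),
      red a = A ord0 ord0
    & s =1 endo_map].

End Expression.

Section ES2Theory.

Variables (p : nat) (hp : prime p) (m : nat).
Notation G := (ES2 hp m).
Notation Z := ('Z([set: G]))%g.

Lemma ES2_mulE (x y : G) : (x * y)%g = ES2_mul x y. Proof. by []. Qed.

Lemma ES2_centerE : Z = [set g : G |
  [&& eu1 g \in pZ p, eu g == 0, ew1 g == 0 & ew g == 0]].
Proof.
apply/setP=> g; rewrite inE in_setT /= inE; apply/centP/and4P.
  move=> cg; have cgE (h : G) : commute g h by apply: cg; rewrite in_setT.
  have E (h : G) : i21 (ew1 h * red (eu1 g) + dot (eu g) (ew h))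
                 = i21 (ew1 g * red (eu1 h) + dot (eu h) (ew g)).
    move: (congr1 (@eu1 _ _ _) (cgE h)); rewrite !ES2_mulE /= !i21Mr //.
    by rewrite (addrC (eu1 h)) -!addrA => /addrI/addrI; rewrite !i21D.
  have {}E h := i21_inj hp (E h); split.
  - rewrite mem_pZ //; move/eqP: (E (MkES2 hp 0 0 1 0)) => /=.
    by rewrite mul1r dot0r dot0l (red0 hp) mulr0 !addr0.
  - apply/eqP/colP=> i; move/eqP: (E (MkES2 hp 0 0 0 (delta_mx i 0))) => /=.
    by rewrite dot_deltar (red0 hp) mul0r mulr0 dot0l !add0r mxE => /eqP.
  - move/eqP: (E (MkES2 hp 1 0 0 0)) => /=.
    by rewrite dot0l dot0r red1 // mulr1 mul0r !addr0 eq_sym.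
  apply/eqP/colP=> i; move/eqP: (E (MkES2 hp 0 (delta_mx i 0) 0 0)) => /=.
  by rewrite dot_deltal (red0 hp) mul0r mulr0 dot0r !add0r mxE => /eqP.
case: g => a b c d /= [a0 /eqP-> /eqP-> /eqP->] [a' b' c' d'] _.
rewrite /commute !ES2_mulE /ES2_mul /= !add0r !addr0.
move: a0; rewrite mem_pZ // => /eqP a0.
by rewrite !i21Mr // a0 mulr0 mul0r dot0l dot0r (i21_0 hp) !addr0 addrC.
Qed.

Lemma utildeM (x y : G) : utilde (x * y)%g = utilde x + utilde y.
Proof.
rewrite /utilde add_col_mx /= !redD // (i21Mr hp) !red_i21 // !addr0.
by congr col_mx; apply/matrixP=> i j; rewrite !mxE.
Qed.

Lemma wtildeM (x y : G) : wtilde (x * y)%g = wtilde x + wtilde y.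
Proof.
by rewrite /wtilde add_col_mx; congr col_mx; apply/matrixP=> i j; rewrite !mxE.
Qed.

Lemma coset_ES2_eq (x y : G) :
  coset Z x = coset Z y <-> utilde x = utilde y /\ wtilde x = wtilde y.
Proof.
have nZ (g : G) : g \in ('N(Z))%g.
  by rewrite (subsetP (gFnorm _ [set: G])) ?in_setT.
split=> [/(rcoset_kercosetP (nZ x) (nZ y))/rcosetP[z + ->]|].
  rewrite /= ES2_centerE inE mem_pZ // => /and4P[/eqP z1 /eqP z2 /eqP z3 /eqP z4].
  rewrite /utilde /wtilde /= !redD // (i21Mr hp) !red_i21 //.
  by rewrite z1 z2 z3 z4 !add0r !addr0.
case=> Eu Ew; apply/(rcoset_kercosetP (nZ x) (nZ y)).
rewrite mem_rcoset /= ES2_centerE inE mem_pZ //.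
move: Eu Ew => /eq_col_mx[/matrixP/(_ 0 0) + eu_] /eq_col_mx[/matrixP/(_ 0 0) + ew_].
rewrite !mxE => u1_ w1_.
by rewrite /= !redD // redN // !i21Mr // !red_i21 // eu_ ew_ u1_ w1_
  !addr0 !subrr !eqxx.
Qed.

Lemma coordq_coset (g : G) : coordq (coset Z g) = col_mx (utilde g) (wtilde g).
Proof.
have/coset_ES2_eq[E1 E2] : coset Z (repr (coset Z g)) = coset Z g.
  by rewrite coset_reprK.
by rewrite /coordq E1 E2.
Qed.

Lemma induced_coset (s : {ffun G -> G}) (g : G) : s \in Endo G ->
  induced s (coset Z g) = coset Z (s g).
Proof.
rewrite inE => /morphicP sM; have {}sM x y : s (x * y)%g = (s x * s y)%g.
  by apply: sM; rewrite in_setT.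
rewrite /induced.
have [z Zz ->] : exists2 z, z \in Z & repr (coset Z g) = (z * g)%g.
  have nZ h : h \in ('N(Z))%g.
    by rewrite (subsetP (gFnorm _ [set: G])) ?in_setT.
  have /(rcoset_kercosetP (nZ _) (nZ _))/rcosetP[z Zz Dz] :
    coset Z (repr (coset Z g)) = coset Z g by rewrite coset_reprK.
  by exists z.
rewrite ES2_centerE inE in Zz; case/and4P: Zz => /(pZ_i21 hp)[c z1] /eqP z2 /eqP z3 /eqP z4.
pose x1 : G := MkES2 hp 1 0 0 0; pose y1 : G := MkES2 hp 0 0 c 0.
have Ez : (z * (y1 * x1) = x1 * y1)%g.
  case: z z1 z2 z3 z4 => a b b' d /= -> -> -> ->.
  rewrite !ES2_mulE /ES2_mul /= !dot0l !(i21_0 hp) !mulr0 !mulr1 !add0r.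
  by rewrite (i21Mr hp) (red_i21 hp) mulr0 (i21_0 hp) !addr0 addrC.
have {}Ez := congr1 s Ez; rewrite !sM in Ez.
have Eu := congr1 (@utilde _ _ _) Ez; have Ew := congr1 (@wtilde _ _ _) Ez.
rewrite !utildeM [utilde (s x1) + _]addrC in Eu.
rewrite !wtildeM [wtilde (s x1) + _]addrC in Ew.
apply/coset_ES2_eq; rewrite sM utildeM wtildeM.
move: Eu Ew => /(canRL (addrK _)) -> /(canRL (addrK _)) ->.
by rewrite !subrr !add0r.
Qed.

Lemma ES2_center_expg (z : G) k : z \in Z ->
  (z ^+ k)%g = MkES2 hp (eu1 z *+ k) 0 0 0.
Proof.
rewrite ES2_centerE inE => /and4P[z1 /eqP z2 /eqP z3 /eqP z4].
elim: k => [|k IHk]; first by rewrite expg0 mulr0n.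
rewrite expgS IHk ES2_mulE /ES2_mul /= z2 z3 z4 dot0l (i21_0 hp) mul0r.
by rewrite !addr0 mulrS.
Qed.

Lemma symp_formP (z x y : G) : generator Z z ->
  [~ x, y]%g = (z ^+ symp_form p z (coset Z x) (coset Z y))%g.
Proof.
move=> /eqP Dz.
have nZ h : h \in ('N(Z))%g.
  by rewrite (subsetP (gFnorm _ [set: G])) ?in_setT.
have Zr h : exists2 c, c \in Z & repr (coset Z h) = (c * h)%g.
  have /(rcoset_kercosetP (nZ _) (nZ _))/rcosetP[c Zc Dc] :
    coset Z (repr (coset Z h)) = coset Z h by rewrite coset_reprK.
  by exists c.
have cZ c h : c \in Z -> [~ c, h]%g = 1%g.
  by move=> /centerP[_ cc]; apply/eqP/commgP; apply: cc; rewrite in_setT.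
have cZ' c h : c \in Z -> [~ h, c]%g = 1%g.
  by move=> Zc; rewrite -invg_comm cZ // invg1.
have ZR h k : [~ h, k]%g \in Z.
  apply: (coset_idr (nZ _)).
  have -> : 1%g = coset Z (1%g : G) by rewrite morph1.
  apply/coset_ES2_eq; rewrite /commg /conjg.
  split; rewrite ?utildeM ?wtildeM.
    have u0 : utilde (1%g : G) = 0.
      by apply: (addrI (utilde (1%g : G))); rewrite -utildeM mulg1 addr0.
    have uV j : utilde (j^-1)%g = - utilde (j : G).
      by apply/eqP; rewrite -addr_eq0 -utildeM mulVg u0.
    by rewrite !uV u0 [utilde h + _]addrC addKr addNr.
  have w0 : wtilde (1%g : G) = 0.
    by apply: (addrI (wtilde (1%g : G))); rewrite -wtildeM mulg1 addr0.
  have wV j : wtilde (j^-1)%g = - wtilde (j : G).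
    by apply/eqP; rewrite -addr_eq0 -wtildeM mulVg w0.
  by rewrite !wV w0 [wtilde h + _]addrC addKr addNr.
have Er : [~ repr (coset Z x), repr (coset Z y)]%g = [~ x, y]%g.
  have [c Zc ->] := Zr x; have [d Zd ->] := Zr y.
  by rewrite commMgJ cZ // conj1g mul1g commgMJ (cZ' d) // conj1g mulg1.
rewrite /symp_form; case: pickP => [k /eqP<- // | nok].
have Zz : z \in Z by rewrite Dz cycle_id.
have /cycleP[k Dk] : [~ x, y]%g \in <[z]>%g by rewrite -Dz.
case/negP: (negbT (nok k%:R)); rewrite Er Dk !ES2_center_expg // (val_Fp_nat hp).
move: Zz; rewrite ES2_centerE inE => /and4P[/(pZ_i21 hp)[c ->] _ _ _].
have Ep j : i21 c *+ j = i21 (c *+ j).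
  by elim: j => [|j IHj]; rewrite ?(i21_0 hp) // !mulrS IHj (i21D hp).
by rewrite !Ep -[c *+ k]mulr_natr -[c *+ (k %% p)]mulr_natr (Fp_nat_mod hp).
Qed.

End ES2Theory.

(* Main.v *)
From HB Require Import structures.
Require Import Defs.
From mathcomp Require Import all_boot all_order all_algebra.
From mathcomp Require Import all_fingroup all_solvable.
From mathcomp Require Import ring zify.

(* An endomorphism s of G = ES_2(p, n) acts on the centre by z |-> z ^ l, where
   l is read off s(x_1) because x_1 ^ p generates the centre.  Since s commutes
   with commutators and with p-th powers, the matrix S it induces on F_p^(2n)
   multiplies the symplectic form by l, and its first row is (l, 0, ..., 0).
   Conversely the group law of G is a bilinear cocycle on F_p^(2n); its
   pullback by S differs from l times itself by the coboundary of an explicit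
   quadratic form, so that the lifts of S form a torsor under linear forms.

   Automorphisms are produced from symplectic matrices: a transvection along
   y - x sends x to y when x and y are not orthogonal, and one intermediate
   point handles the orthogonal case.  The transvection has the required first
   row as soon as x and y have the same first coordinate.  Inner automorphisms
   move a noncentral element through its whole coset modulo the centre. *)

Set Implicit Arguments.
Unset Strict Implicit.
Unset Printing Implicit Defensive.

Import GRing.Theory.
Local Open Scope ring_scope.

(** * Additive maps between vector spaces over the prime field *)

Section LinearForms.

Variable p : nat.

(** Every scalar of ['F_p] is the residue of a natural number, so scaling is iterated addition. *)
Lemma additive_scale (V W : lmodType 'F_p) (f : V -> W) :
  {morph f : x y / x + y} -> forall c, {morph f : x / c *: x}.
Proof.
move=> fD c x; have f0 : f 0 = 0 by apply: (addrI (f 0)); rewrite -fD !addr0.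
have fn k : f (x *+ k) = f x *+ k.
  by elim: k => [|k IHk]; rewrite ?mulr0n ?f0 // !mulrS fD IHk.
by rewrite -[c]natr_Zp !scaler_nat fn.
Qed.

Lemma additive_sum (V W : zmodType) (f : V -> W) (I : finType) (F : I -> V) :
  {morph f : x y / x + y} -> f (\sum_i F i) = \sum_i f (F i).
Proof.
move=> fD; have f0 : f 0 = 0 by apply: (addrI (f 0)); rewrite -fD !addr0.
exact: (big_morph f fD f0).
Qed.

Lemma cV_delta k (v : 'cV['F_p]_k) : v = \sum_i v i 0 *: delta_mx i 0.
Proof.
by rewrite {1}[v]matrix_sum_delta; apply: eq_bigr => i _; rewrite big_ord1.
Qed.

Lemma additive_mx k l (f : 'cV['F_p]_k -> 'cV['F_p]_l) :
  {morph f : x y / x + y} ->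
  forall v, f v = (\matrix_(i, j) f (delta_mx j 0) i 0) *m v.
Proof.
move=> fD v; rewrite {1}[v]cV_delta additive_sum //.
apply/colP=> i; rewrite summxE mxE; apply: eq_bigr => j _.
by rewrite additive_scale // !mxE mulrC.
Qed.

(** Packages a row vector as a [{scalar _}], the type of [alpha] and [beta] in [endo_map]. *)
Definition mx_form k (r : 'rV['F_p]_k) (v : 'cV['F_p]_k) : 'F_p := (r *m v) 0 0.

Fact mx_form_is_scalar k (r : 'rV['F_p]_k) : scalar (mx_form r).
Proof. by move=> c u v; rewrite /mx_form mulmxDr -scalemxAr !mxE. Qed.

HB.instance Definition _ k (r : 'rV['F_p]_k) :=
  GRing.isLinear.Build 'F_p 'cV['F_p]_k 'F_p _ (mx_form r) (mx_form_is_scalar r).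

Lemma additive_scalar k (f : 'cV['F_p]_k -> 'F_p) :
  {morph f : x y / x + y} -> exists L : {scalar 'cV['F_p]_k}, L =1 f.
Proof.
move=> fD; exists (mx_form (\row_j f (delta_mx j 0))) => v /=.
rewrite {2}[v]cV_delta additive_sum // /mx_form mxE; apply: eq_bigr => j _.
by rewrite (additive_scale (W := ('F_p)^o) fD) !mxE mulrC.
Qed.

End LinearForms.

(** * Bilinear forms and the quadratic correction term *)

Section BilinearForms.

Variable F : fieldType.

Definition bform k l (M : 'M[F]_(k, l)) (x : 'cV_k) (y : 'cV_l) : F :=
  (x^T *m M *m y) 0 0.

Lemma bformDl k l (M : 'M[F]_(k, l)) x x' y :
  bform M (x + x') y = bform M x y + bform M x' y.
Proof. by rewrite /bform linearD /= !mulmxDl mxE. Qed.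

Lemma bformDr k l (M : 'M[F]_(k, l)) x y y' :
  bform M x (y + y') = bform M x y + bform M x y'.
Proof. by rewrite /bform mulmxDr mxE. Qed.

Lemma bformD k l (M N : 'M[F]_(k, l)) x y :
  bform (M + N) x y = bform M x y + bform N x y.
Proof. by rewrite /bform mulmxDr mulmxDl mxE. Qed.

Lemma bformZ k l c (M : 'M[F]_(k, l)) x y : bform (c *: M) x y = c * bform M x y.
Proof. by rewrite /bform -scalemxAr -scalemxAl mxE. Qed.

Lemma bformZl k l c (M : 'M[F]_(k, l)) x y : bform M (c *: x) y = c * bform M x y.
Proof. by rewrite /bform linearZ /= -!scalemxAl mxE. Qed.

Lemma bformZr k l c (M : 'M[F]_(k, l)) x y : bform M x (c *: y) = c * bform M x y.
Proof. by rewrite /bform -scalemxAr mxE. Qed.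

Lemma bformN k l (M : 'M[F]_(k, l)) x y : bform (- M) x y = - bform M x y.
Proof. by rewrite /bform mulmxN mulNmx mxE. Qed.

Lemma bformNl k l (M : 'M[F]_(k, l)) x y : bform M (- x) y = - bform M x y.
Proof. by rewrite -scaleN1r bformZl mulN1r. Qed.

Lemma bformT k l (M : 'M[F]_(k, l)) x y : bform M^T y x = bform M x y.
Proof.
have E : (y^T *m M^T *m x) = (x^T *m M *m y)^T by rewrite !trmx_mul trmxK mulmxA.
by rewrite /bform E mxE.
Qed.

Lemma bform_mul k l k' l' (M : 'M[F]_(k, l)) (P : 'M_(k, k')) (Q : 'M_(l, l')) x y :
  bform M (P *m x) (Q *m y) = bform (P^T *m M *m Q) x y.
Proof. by rewrite /bform trmx_mul !mulmxA. Qed.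

Lemma bform1_mul k k' l' (P : 'M[F]_(k, k')) (Q : 'M_(k, l')) x y :
  bform 1%:M (P *m x) (Q *m y) = bform (P^T *m Q) x y.
Proof. by rewrite bform_mul mulmx1. Qed.

Lemma bform_delta k l (M : 'M[F]_(k, l)) i j :
  bform M (delta_mx i 0) (delta_mx j 0) = M i j.
Proof.
by rewrite /bform trmx_delta -rowE -colE !mxE.
Qed.

Lemma bform_inj k l (M N : 'M[F]_(k, l)) : bform M =2 bform N -> M = N.
Proof. by move=> E; apply/matrixP=> i j; rewrite -!bform_delta E. Qed.

Lemma tr_Delta (K : finFieldType) n : (Delta K n)^T = - Delta K n.
Proof.
rewrite /Delta tr_block_mx opp_block_mx !trmx0 !oppr0 opprK.
by rewrite linearN /= !trmx1.
Qed.

(** The quadratic terms of [endo_s]. When [A^T *m D] and [C^T *m B] are symmetric, the factor 1/2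
    makes them the polarizations of their own terms. *)
Definition quad_part k (A B C D : 'M[F]_k) (u w : 'cV[F]_k) : F :=
  2%:R^-1 * bform (A^T *m D) u u + 2%:R^-1 * bform (C^T *m B) w w
  + bform (C^T *m D) w u.

(* quad_part is a cochain whose coboundary corrects the cocycle pulled back
   by the block matrix with columns (A, D), (C, B). *)
Lemma quad_partD k (A B C D : 'M[F]_k) l u w u' w' :
    2%:R != 0 :> F ->
    A^T *m D = D^T *m A -> C^T *m B = B^T *m C ->
    A^T *m B = D^T *m C + l%:M ->
  quad_part A B C D (u + u') (w + w') + l * bform 1%:M u w' =
  quad_part A B C D u w + quad_part A B C D u' w' +
  bform 1%:M (A *m u + C *m w) (D *m u' + B *m w').
Proof.
move=> nz2 eAD eCB eAB.
rewrite !bformDl !bformDr !bform1_mul eAB bformD -[l%:M]scalemx1 bformZ.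
have AD x y : bform (A^T *m D) x y = bform (A^T *m D) y x.
  by rewrite -bformT trmx_mul trmxK eAD.
have CB x y : bform (C^T *m B) x y = bform (C^T *m B) y x.
  by rewrite -bformT trmx_mul trmxK eCB.
have CD x y : bform (D^T *m C) x y = bform (C^T *m D) y x.
  by rewrite -bformT trmx_mul trmxK.
rewrite /quad_part !bformDl !bformDr CD (AD u' u) (CB w' w).
by field.
Qed.

End BilinearForms.

(** * The symplectic condition in blocks *)

Section SymplecticBlocks.

Variables (K : finFieldType) (n : nat) (A B C D : 'M[K]_n) (l : K).

(** Of the four block equations, the lower left one is the transpose of the upper right one up to
    sign, so three remain. *)
Lemma symp_blocks :
  (block_mx A C D B)^T *m Delta K n *m block_mx A C D B = l *: Delta K n <->
  [/\ A^T *m D = D^T *m A, C^T *m B = B^T *m C & A^T *m B = D^T *m C + l%:M].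
Proof.
rewrite /Delta tr_block_mx !mulmx_block !mulmx0 !mulmxN !mulmx1 !add0r !addr0.
rewrite scale_block_mx !scaler0 scalerN scalemx1 !mulNmx; split.
  case/eq_block_mx=> E1 E2 _ E3; split.
  - by apply/eqP; rewrite -subr_eq0 addrC E1.
  - by apply/eqP; rewrite -subr_eq0 addrC E3.
  - by rewrite -E2 addNKr.
case=> E1 E2 E3; rewrite E1 E2 E3 !addNr addKr; congr block_mx.
have := congr1 trmx E3; rewrite linearD /= !trmx_mul !trmxK tr_scalar_mx => ->.
by rewrite opprD addrAC addNr add0r.
Qed.

End SymplecticBlocks.

(** * Coordinates on the group *)

Section Coordinates.

Variables (p : nat) (hp : prime p) (m : nat).
Notation G := (ES2 hp m).
Notation Z := ('Z([set: G]))%g.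
Notation V := 'cV['F_p]_(m.+1 + m.+1).
Implicit Types (x y g : G) (v : V) (c : 'F_p).

Lemma i21Mn c k : i21 c *+ k = i21 (c *+ k).
Proof. by elim: k => [|k IHk]; rewrite ?(i21_0 hp) // !mulrS IHk (i21D hp). Qed.

(** Agrees with [coordq] on cosets ([coordq_crd]), but lives on elements, so that no representative
    has to be chosen. *)
Definition crd g : V := col_mx (utilde g) (wtilde g).

(** Parametrizes the centre by ['F_p]; [center_zcP] shows that nothing is missed. *)
Definition zc c : G := MkES2 hp (i21 c) 0 0 0.

Lemma crdM x y : crd (x * y)%g = crd x + crd y.
Proof. by rewrite /crd utildeM wtildeM; apply: esym; apply: add_col_mx. Qed.

Lemma crd1 : crd 1%g = 0.
Proof. by apply: (addrI (crd 1%g)); rewrite -crdM mulg1 addr0. Qed.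

Lemma crdV x : crd x^-1%g = - crd x.
Proof. by apply/eqP; rewrite -addr_eq0 -crdM mulVg crd1. Qed.

Lemma crdX x k : crd (x ^+ k)%g = crd x *+ k.
Proof. by elim: k => [|k IHk]; rewrite ?crd1 // expgS crdM IHk mulrS. Qed.

Lemma bform1_dot k (u w : 'cV['F_p]_k) : bform 1%:M u w = dot u w.
Proof. by rewrite /bform mulmx1 mxE; apply: eq_bigr => i _; rewrite mxE. Qed.

(** The term [i21 (ew1 y) * eu1 x] depends on [eu1 x] only modulo p, so it supplies the first
    summand of the standard pairing. Both corrections in the group law thus merge into one bilinear
    cocycle. *)
Lemma eu1M x y :
  eu1 (x * y)%g = eu1 x + eu1 y + i21 (bform 1%:M (utilde x) (wtilde y)).
Proof.
rewrite ES2_mulE /= (i21Mr hp) -!addrA -(i21D hp); congr (_ + (_ + i21 _)).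
rewrite bform1_dot /dot [RHS](big_ord_recl m); congr (_ + _).
  by rewrite mulrC /utilde /wtilde !mxE !split1 !unlift_none /= !mxE.
by apply: eq_bigr => i _; rewrite /utilde /wtilde !mxE !split1 !liftK.
Qed.

Lemma ES2_ext x y : eu1 x = eu1 y -> crd x = crd y -> x = y.
Proof.
case: x y => [a b c d] [a' b' c' d'] /= -> /eq_col_mx[].
move=> /(@eq_col_mx _ 1)[_ /= ->] /(@eq_col_mx _ 1)[/matrixP/(_ 0 0) + /= ->].
by rewrite !mxE /= => ->.
Qed.

Definition first : 'I_(m.+1 + m.+1) := lshift m.+1 ord0.

Lemma crd_first x : crd x first 0 = red (eu1 x).
Proof. by rewrite /crd col_mxEu /utilde !mxE split1 unlift_none /= mxE. Qed.

Lemma mem_H x : (x \in ES2_H hp m) = (red (eu1 x) == 0).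
Proof. by rewrite inE mem_pZ. Qed.

Lemma utilde_zc c : utilde (zc c) = 0.
Proof. by rewrite /utilde /= (red_i21 hp) -[RHS]col_mx0. Qed.

Lemma wtilde_zc c : wtilde (zc c) = 0.
Proof. by rewrite /wtilde /= -[RHS]col_mx0. Qed.

Lemma crd_zc c : crd (zc c) = 0.
Proof. by rewrite /crd utilde_zc wtilde_zc; apply: col_mx0. Qed.

Lemma zc0 : zc 0 = 1%g.
Proof. by rewrite /zc (i21_0 hp). Qed.

Lemma zc_inj : injective zc.
Proof. by move=> c d [/(i21_inj hp)]. Qed.

Lemma crd0_zc x : crd x = 0 -> exists c, x = zc c.
Proof.
move=> x0; have /(pZ_i21 hp)[c Dc] : eu1 x \in pZ p.
  by rewrite (mem_pZ hp) -crd_first x0 mxE.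
by exists c; apply: ES2_ext; rewrite ?crd_zc.
Qed.

Lemma mem_center x : (x \in Z) = (crd x == 0).
Proof.
rewrite ES2_centerE inE; apply/idP/eqP=> [/and4P[a0 /eqP b0 /eqP c0 /eqP d0]|].
  have [c Dc] := pZ_i21 hp a0; rewrite -(crd_zc c); congr crd.
  by case: x a0 b0 c0 d0 Dc => a b c' d /= _ -> -> -> ->.
case/crd0_zc=> c ->.
by rewrite mem_pZ // red_i21 // !eqxx.
Qed.

Lemma zc_center c : zc c \in Z.
Proof. by rewrite mem_center crd_zc. Qed.

Lemma eu1_zcM x c : eu1 (x * zc c)%g = eu1 x + i21 c.
Proof.
by rewrite eu1M wtilde_zc /bform mulmx0 mxE (i21_0 hp) addr0.
Qed.

Lemma zcX c k : (zc c ^+ k)%g = zc (c *+ k).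
Proof. by rewrite ES2_center_expg ?zc_center //= i21Mn. Qed.

Lemma crd_inj_zc x y : crd x = crd y -> exists c, x = (y * zc c)%g.
Proof.
move=> E; have [|c Dc] := @crd0_zc (y^-1 * x)%g.
  by rewrite crdM crdV E addNr.
by exists c; rewrite -Dc mulKVg.
Qed.

Definition sform (v w : V) : 'F_p := bform (Delta 'F_p m.+1) v w.

Lemma sformE (u w u' w' : 'cV['F_p]_m.+1) :
  sform (col_mx u w) (col_mx u' w') = bform 1%:M u w' - bform 1%:M w u'.
Proof.
rewrite /sform /Delta /bform tr_col_mx mul_row_block !mulmx0 add0r addr0.
by rewrite mulmx1 mulmxN mul_row_col mulmx1 mulNmx addrC !mxE.
Qed.

Lemma sform_anti v w : sform v w = - sform w v.
Proof. by rewrite /sform -bformT tr_Delta bformN. Qed.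

(** The defect of commutativity is the antisymmetrized cocycle of [eu1M], which is the standard
    symplectic form. *)
Lemma mulgC_sform x y : (x * y = y * x * zc (sform (crd x) (crd y)))%g.
Proof.
apply: ES2_ext; last by rewrite !crdM crd_zc addr0 addrC.
rewrite eu1_zcM !eu1M sformE -[bform 1%:M (wtilde x) _]bformT trmx1.
by rewrite i21D // i21N //; ring.
Qed.

Lemma commg_sform x y : [~ x, y]%g = zc (sform (crd x) (crd y)).
Proof.
by have := commgC x y; rewrite [LHS]mulgC_sform => /mulgI->.
Qed.

Lemma conjg_sform x y : (x ^ y)%g = (x * zc (sform (crd x) (crd y)))%g.
Proof. by rewrite -commg_sform conjg_mulR. Qed.

(** Each of the ['C(k, 2)] pairs of factors contributes the cocycle once. *)
Lemma eu1X x k : eu1 (x ^+ k)%g =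
  eu1 x *+ k + i21 (bform 1%:M (utilde x) (wtilde x) *+ 'C(k, 2)).
Proof.
elim: k => [|k IHk]; first by rewrite expg0 mulr0n (i21_0 hp) addr0.
rewrite expgS eu1M IHk mulrS -!addrA -i21D //; congr (_ + (_ + i21 _)).
have -> : wtilde (x ^+ k)%g = wtilde x *+ k.
  elim: k {IHk} => [|k IHk]; first by rewrite expg0 -zc0 wtilde_zc.
  by rewrite expgS wtildeM IHk mulrS.
by rewrite -scaler_nat bformZr mulr_natl binS bin1 mulrnDr addrC.
Qed.

(** For odd p the coefficient ['C(p, 2)] is a multiple of p and kills the cocycle term, so the p-th
    power reads off the first coordinate. *)
Lemma expg_p (hodd : odd p) x : (x ^+ p)%g = zc (red (eu1 x)).
Proof.
apply: ES2_ext; last by rewrite crdX crd_zc -scaler_nat (pchar_Fp_0 hp) scale0r.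
rewrite eu1X /= bin2odd // mulrnA -[bform _ _ _ *+ p]mulr_natr (pchar_Fp_0 hp).
rewrite mulr0 mul0rn (i21_0 hp) addr0 -mulr_natr -[eu1 x in LHS]natr_Zp -natrM mulnC.
by rewrite -i21_nat.
Qed.

(** A section of [crd] as a map of sets, not a morphism: the first coordinate is lifted to its least
    residue. *)
Definition of_crd v : G :=
  let u : 'cV_(1 + m) := usubmx v in let w : 'cV_(1 + m) := dsubmx v in
  MkES2 hp ((usubmx u 0 0 : nat)%:R) (dsubmx u) (usubmx w 0 0) (dsubmx w).

Lemma of_crdK v : crd (of_crd v) = v.
Proof.
rewrite -[RHS]vsubmxK /crd /utilde /wtilde; congr col_mx.
  rewrite /of_crd /= red_nat // natr_Zp -[RHS](@vsubmxK _ 1).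
  apply: (congr2 (@col_mx _ 1 m 1)) => //.
  by apply/matrixP=> i j; rewrite !ord1 mxE.
rewrite /of_crd /= -[RHS](@vsubmxK _ 1); apply: (congr2 (@col_mx _ 1 m 1)) => //.
by apply/matrixP=> i j; rewrite !ord1 mxE.
Qed.

Lemma crd_xgen i : crd (xgen hp i) = delta_mx (lshift m.+1 i) 0.
Proof.
apply/colP=> k; rewrite /crd /xgen; case: (splitP k) => j Dk.
  have ->: k = lshift _ j by apply/val_inj.
  rewrite col_mxEu [RHS]mxE (inj_eq (@lshift_inj _ _)) eqxx andbT.
  rewrite /utilde !mxE split1.
  case: unliftP => [i'|] ->; case: unliftP => [j'|] -> /=;
    by rewrite !mxE ?eqxx ?andbT ?red0 ?red1.
have ->: k = rshift _ j by apply/val_inj.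
rewrite col_mxEd [RHS]mxE eq_sym eq_lrshift /wtilde !mxE split1.
by case: unliftP => [i'|] _; case: unliftP => [j'|] _ /=; rewrite !mxE.
Qed.

Lemma crd_ygen i : crd (ygen hp i) = delta_mx (rshift m.+1 i) 0.
Proof.
apply/colP=> k; rewrite /crd /ygen; case: (splitP k) => j Dk.
  have ->: k = lshift _ j by apply/val_inj.
  rewrite col_mxEu [RHS]mxE eq_lrshift /utilde !mxE split1.
  by case: unliftP => [i'|] _; case: unliftP => [j'|] _ /=; rewrite !mxE ?red0.
have ->: k = rshift _ j by apply/val_inj.
rewrite col_mxEd [RHS]mxE (inj_eq (@rshift_inj _ _)) eqxx andbT.
rewrite /wtilde !mxE split1.
case: unliftP => [i'|] ->; case: unliftP => [j'|] -> /=;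
  by rewrite !mxE ?eqxx ?andbT.
Qed.

Lemma coordq_crd x : @coordq p hp m (coset Z x) = crd x.
Proof. exact: coordq_coset. Qed.

Lemma basisq_crd j : @coordq p hp m (basisq hp j) = delta_mx j 0.
Proof.
rewrite /basisq; case: (splitP j) => i Dj; rewrite coordq_crd.
  by rewrite crd_xgen; congr delta_mx; apply/val_inj.
by rewrite crd_ygen; congr delta_mx; apply/val_inj.
Qed.

End Coordinates.

(** * Endomorphisms *)

Section Endomorphisms.

Variables (p : nat) (hp : prime p) (hodd : odd p) (m : nat).
Notation G := (ES2 hp m).
Notation Z := ('Z([set: G]))%g.

Lemma EndoP (s : {ffun G -> G}) :
  reflect {morph s : x y / (x * y)%g} (s \in Endo G).
Proof.
rewrite inE; apply: (iffP morphicP) => [sM x y | sM x y _ _]; last exact: sM.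
by apply: sM; rewrite inE.
Qed.

Lemma two_neq0 : 2%:R != 0 :> 'F_p.
Proof.
rewrite -(dvdn_pcharf (pchar_Fp hp)) gtnNdvd //.
by rewrite ltn_neqAle prime_gt1 // andbT; apply: contraL hodd => /eqP<-.
Qed.

Lemma xgen0 : xgen hp ord0 = MkES2 hp 1 0 (0 : 'F_p) (0 : 'cV_m).
Proof. by rewrite /xgen unlift_none. Qed.

Lemma crd_x0 : crd (xgen hp ord0) = delta_mx (first m) 0.
Proof. exact: crd_xgen. Qed.

Lemma xgen0X k : (xgen hp ord0 ^+ k)%g = MkES2 hp k%:R 0 (0 : 'F_p) (0 : 'cV_m).
Proof.
elim: k => [|k IHk]; rewrite ?expg0 // expgS IHk xgen0 ES2_mulE /ES2_mul /=.
by rewrite dot0l i21_0 // mul0r !addr0 mulrS.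
Qed.

(** The cocycle pairs the u-part of the left factor with the w-part of the right one; with the
    w-part placed first, every such term vanishes. *)
Lemma ES2_decomp (g : G) :
  g = (MkES2 hp 0 0 (ew1 g) (ew g)
       * (xgen hp ord0 ^+ eu1 g * MkES2 hp 0 (eu g) 0 0))%g.
Proof.
rewrite xgen0X natr_Zp; case: g => a b c d; rewrite !ES2_mulE /ES2_mul /=.
by rewrite !dot0l i21_0 // !mul0r mulr0 !addr0 !add0r.
Qed.

(** * The scalar and the matrix attached to an endomorphism *)

Section Morphism.

Variable s : G -> G.
Hypothesis sM : {morph s : x y / (x * y)%g}.

(** By [endo_zc] this is the scalar by which [s] acts on the centre. *)
Definition multiplier : 'F_p := red (eu1 (s (xgen hp ord0))).
Local Notation l := multiplier.

Lemma endo1 : s 1%g = 1%g.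
Proof. by apply: (mulgI (s 1%g)); rewrite -sM !mulg1. Qed.

Lemma endoX x k : s (x ^+ k)%g = (s x ^+ k)%g.
Proof. by elim: k => [|k IHk]; rewrite ?endo1 // !expgS sM IHk. Qed.

Lemma endoV x : s (x^-1)%g = ((s x)^-1)%g.
Proof. by apply: (mulIg (s x)); rewrite -sM !mulVg endo1. Qed.

Lemma endo_zc c : s (zc hp m c) = zc hp m (l * c).
Proof.
have -> : zc hp m c = ((xgen hp ord0 ^+ p) ^+ c)%g.
  by rewrite expg_p // xgen0 /= red1 // zcX natr_Zp.
by rewrite !endoX expg_p // zcX -{2}[c]natr_Zp mulr_natr.
Qed.

(** By [expg_p] the first coordinate is carried by the central element [x ^+ p], on which [s] acts
    by [l]. *)
Lemma red_endo x : red (eu1 (s x)) = l * red (eu1 x).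
Proof. by apply: (@zc_inj _ hp m); rewrite -expg_p // -endoX expg_p // endo_zc. Qed.

Lemma endo_H x : x \in ES2_H hp m -> s x \in ES2_H hp m.
Proof. by rewrite !mem_H red_endo => /eqP->; rewrite mulr0. Qed.

Lemma crd_endo_eq (x y : G) : crd x = crd y -> crd (s x) = crd (s y).
Proof. by case/crd_inj_zc=> c ->; rewrite sM crdM endo_zc crd_zc addr0. Qed.

Lemma sform_endo (x y : G) :
  sform (crd (s x)) (crd (s y)) = l * sform (crd x) (crd y).
Proof.
apply: (@zc_inj _ hp m); rewrite -endo_zc -!commg_sform /commg /conjg.
by rewrite !sM !endoV.
Qed.

Lemma induced_endo (x : G) : induced s (coset Z x) = coset Z (s x).
Proof.
have sE : finfun s \in Endo G by apply/EndoP=> y z; rewrite !ffunE sM.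
by have := induced_coset x sE; rewrite /induced !ffunE.
Qed.

Lemma mx_of_endo (x : G) : mx_of (@induced G s) *m crd x = crd (s x).
Proof.
(* The section [of_crd] is multiplicative only modulo the centre; [crd_endo_eq] absorbs that defect,
   so [f] is additive and hence a matrix. *)
pose f v := crd (s (of_crd hp v)).
have fD : {morph f : v w / v + w}.
  move=> v w; rewrite /f -crdM -sM; apply: crd_endo_eq.
  by rewrite crdM !of_crdK.
transitivity (f (crd x)); last by apply: crd_endo_eq; rewrite of_crdK.
rewrite (additive_mx fD); congr (_ *m _); apply/matrixP=> i j.
rewrite [LHS]mxE [RHS]mxE; have [b Db] : exists b, basisq hp j = coset Z b.
  by rewrite /basisq; case: split => k; eexists.
rewrite Db induced_endo coordq_crd /f.
congr (fun_of_matrix _ i 0); apply: crd_endo_eq.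
by rewrite of_crdK -coordq_crd -Db basisq_crd.
Qed.

Lemma mx_of_symp :
  (mx_of (@induced G s))^T *m Delta 'F_p m.+1 *m mx_of (@induced G s)
  = l *: Delta 'F_p m.+1.
Proof.
apply: bform_inj => v w; rewrite -bform_mul bformZ.
by rewrite -[v](of_crdK hp) -[w](of_crdK hp) !mx_of_endo; apply: sform_endo.
Qed.

(** This is [red_endo] read on basis vectors; it yields all the vanishing entries in the first rows
    of [A] and [C]. *)
Lemma mx_of_first j :
  mx_of (@induced G s) (first m) j = l * (j == first m)%:R.
Proof.
have -> : mx_of (@induced G s) (first m) j
    = crd (s (of_crd hp (delta_mx j 0))) (first m) 0.
  by rewrite -mx_of_endo of_crdK -colE [RHS]mxE.
by rewrite crd_first red_endo -crd_first of_crdK mxE eqxx andbT eq_sym.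
Qed.

End Morphism.

(** * Maps given by the explicit formula *)

Section Expression.

Variables (A B C D : 'M['F_p]_m.+1) (a : 'Z_(p ^ 2)).
Hypotheses (A0 : forall j, j != ord0 -> A ord0 j = 0)
  (C0 : forall j, C ord0 j = 0) (ra : red a = A ord0 ord0).

Section Map.

Variables (alpha : {scalar 'cV['F_p]_m}) (beta : {scalar 'cV['F_p]_m.+1}).
Notation sigma := (@endo_map p hp m A B C D a alpha beta).

Lemma endo_sE (g : G) : endo_s A B C D alpha beta g =
  alpha (eu g) + beta (wtilde g) + quad_part A B C D (utilde g) (wtilde g).
Proof. by rewrite /endo_s /quad_part !addrA. Qed.

Lemma eu1_endo_map (g : G) :
  eu1 (sigma g) = a * eu1 g
  + i21 (alpha (eu g) + beta (wtilde g) + quad_part A B C D (utilde g) (wtilde g)).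
Proof. by rewrite -endo_sE. Qed.

(** Only the first coordinate needs an argument: the formula puts [a * eu1 g] there, and this
    matches because the first row of the matrix is zero apart from the residue of [a]. *)
Lemma utilde_endo_map (g : G) :
  utilde (sigma g) = A *m utilde g + C *m wtilde g.
Proof.
rewrite -[RHS](@vsubmxK _ 1); apply: (congr2 (@col_mx _ 1 m 1)) => //.
apply/matrixP=> i j; rewrite !ord1 [LHS]mxE /= redD // redM // red_i21 // addr0.
rewrite ra mxE mxE.
have -> : lshift m (0 : 'I_1) = ord0 by apply/val_inj.
have -> : (C *m wtilde g) ord0 0 = 0.
  by rewrite mxE big1 // => k _; rewrite C0 mul0r.
rewrite addr0 mxE (bigD1 ord0) //= big1 => [|k /A0->]; last by rewrite mul0r.
by rewrite addr0 /utilde [in RHS]mxE split1 unlift_none /= mxE.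
Qed.

Lemma wtilde_endo_map (g : G) :
  wtilde (sigma g) = D *m utilde g + B *m wtilde g.
Proof.
rewrite -[RHS](@vsubmxK _ 1); apply: (congr2 (@col_mx _ 1 m 1)) => //.
by apply/matrixP=> i j; rewrite !ord1 [LHS]mxE.
Qed.

Lemma crd_endo_map (g : G) : crd (sigma g) = block_mx A C D B *m crd g.
Proof. by rewrite /crd utilde_endo_map wtilde_endo_map mul_block_col. Qed.

Lemma endo_mapM :
  (block_mx A C D B)^T *m Delta 'F_p m.+1 *m block_mx A C D B
    = A ord0 ord0 *: Delta 'F_p m.+1 ->
  {morph sigma : x y / (x * y)%g}.
Proof.
case/symp_blocks=> eAD eCB eAB x y; apply: ES2_ext; last first.
  apply: etrans (crd_endo_map _) _; apply: esym; apply: etrans (crdM _ _) _.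
  by rewrite (crd_endo_map x) (crd_endo_map y) -mulmxDr [in RHS]crdM.
apply: etrans (eu1_endo_map _) _; apply: esym; apply: etrans (eu1M _ _) _.
rewrite (eu1_endo_map x) (eu1_endo_map y) utilde_endo_map wtilde_endo_map.
apply: esym; rewrite eu1M utildeM wtildeM.
have -> : eu (x * y)%g = eu x + eu y by [].
have := quad_partD (utilde x) (wtilde x) (utilde y) (wtilde y)
  two_neq0 eAD eCB eAB.
move/(canRL (addrK _)) => ->; rewrite !linearD /=.
(* [a] acts on cocycle values through its residue [A ord0 ord0], which is the [l] of
   [quad_partD]. *)
rewrite !mulrDr [a * i21 _]mulrC i21Mr // ra [bform _ _ _ * A _ _]mulrC.
move: (quad_part _ _ _ _ _ _) (quad_part _ _ _ _ _ _) (bform _ _ _) (A _ _ * _).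
move: (a * _) (a * _) (alpha _) (alpha _) (beta _) (beta _) => *.
by rewrite !(i21D hp) !(i21N hp); ring.
Qed.

End Map.

End Expression.

Lemma endo_expr_morph (A B C D : 'M['F_p]_m.+1) a alpha beta (s : G -> G) :
  endo_expr A B C D a alpha beta s -> {morph s : x y / (x * y)%g}.
Proof.
by case=> _ symp [A0 C0] ra sE x y; rewrite !sE endo_mapM.
Qed.

Lemma mx_of_blocks (s : G -> G) (A B C D : 'M['F_p]_m.+1) :
    {morph s : x y / (x * y)%g} ->
    mx_of (@induced G s) = block_mx A C D B ->
  [/\ A ord0 ord0 = multiplier s, (forall j, j != ord0 -> A ord0 j = 0)
    & forall j, C ord0 j = 0].
Proof.
move=> sM E; have F := mx_of_first sM; rewrite E in F; split.
- by have := F (first m); rewrite block_mxEul eqxx mulr1.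
- move=> j nj; have := F (lshift _ j); rewrite block_mxEul => ->.
  by rewrite (inj_eq (@lshift_inj _ _)) (negbTE nj) mulr0.
- move=> j; have := F (rshift _ j); rewrite block_mxEur => ->.
  by rewrite /first eq_rlshift mulr0.
Qed.

(** The first coordinate of [s] and the quadratic model have the same coboundary, so they differ by
    a homomorphism into [pZ p]; its restrictions to the u- and w-parts are [alpha] and [beta]. *)
Lemma endo_exprP (s : G -> G) (A B C D : 'M['F_p]_m.+1) :
    {morph s : x y / (x * y)%g} ->
    mx_of (@induced G s) = block_mx A C D B ->
  exists a alpha beta, endo_expr A B C D a alpha beta s.
Proof.
move=> sM E; have [A00 A0 C0] := mx_of_blocks sM E.
have symp := mx_of_symp sM; rewrite E -A00 in symp.
have [eAD eCB eAB] := (symp_blocks _ _ _ _ _).1 symp.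
pose q (g : G) := quad_part A B C D (utilde g) (wtilde g).
pose x1 := xgen hp (ord0 : 'I_m.+1).
(* Chosen so that the error [t] vanishes at [x1], since neither [alpha] nor [beta] sees the first
   coordinate. *)
pose a := eu1 (s x1) - i21 (q x1).
have ra : red a = A ord0 ord0.
  by rewrite A00 /a redD // redN // red_i21 // oppr0 addr0.
have crds g : utilde (s g) = A *m utilde g + C *m wtilde g
           /\ wtilde (s g) = D *m utilde g + B *m wtilde g.
  have := mx_of_endo sM g; rewrite E /crd mul_block_col.
  by case/eq_col_mx=> <- <-.
(* The error of the quadratic model, introduced through an existential to keep it opaque. *)
have [t tE] : exists t : G -> 'Z_(p ^ 2),
  forall g, t g = eu1 (s g) - a * eu1 g - i21 (q g) by eexists.
have tM x y : t (x * y)%g = t x + t y.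
  rewrite !tE /q sM !eu1M utildeM wtildeM (crds x).1 (crds y).2.
  have := quad_partD (utilde x) (wtilde x) (utilde y) (wtilde y)
    two_neq0 eAD eCB eAB.
  move/(canRL (addrK _)) => ->.
  rewrite !mulrDr [a * i21 _]mulrC i21Mr // ra [bform _ _ _ * A _ _]mulrC.
  move: (quad_part _ _ _ _ _ _) (quad_part _ _ _ _ _ _) (bform _ _ _) (A _ _ * _).
  move: (a * _) (a * _) (eu1 _) (eu1 _) => *.
  by rewrite !(i21D hp) !(i21N hp); ring.
have tZ g : t g \in pZ p.
  rewrite mem_pZ // tE !redD // !redN // red_i21 // oppr0 addr0 redM // ra A00.
  by rewrite red_endo // subrr.
have [h hE] : exists h : G -> 'F_p, forall g, i21 (h g) = t g.
  by exists (fun g => sval (pZ_i21 hp (tZ g))) => g; case: pZ_i21.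
have hM x y : h (x * y)%g = h x + h y.
  by apply: (i21_inj hp); rewrite i21D // !hE tM.
have h1 : h 1%g = 0 by apply: (addrI (h 1%g)); rewrite -hM mulg1 addr0.
have hx k : h (x1 ^+ k)%g = 0.
  have hx1 : h x1 = 0.
    apply: (i21_inj hp); rewrite hE i21_0 // tE {2}/x1 xgen0 /= mulr1 /a.
    by rewrite subKr subrr.
  by elim: k => [|k IHk]; rewrite ?expg0 ?h1 // expgS hM hx1 IHk addr0.
have [|alpha Da] := @additive_scalar p m (fun u => h (MkES2 hp 0 u 0 0)).
  move=> u u'; rewrite -hM; congr h; rewrite ES2_mulE /ES2_mul /=.
  by rewrite mulr0 dot0r i21_0 // !addr0.
have [|beta Db] := @additive_scalar p m.+1
    (fun w => h (MkES2 hp 0 0 (@usubmx _ 1 m 1 w 0 0) (@dsubmx _ 1 m 1 w))).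
  move=> w w'; rewrite -hM; congr h; rewrite ES2_mulE /ES2_mul /=.
  by rewrite mulr0 dot0l i21_0 // !addr0; congr MkES2; rewrite ?mxE // linearD.
exists a, alpha, beta; split=> //.
  by rewrite inE; apply/existsP; exists (A ord0 ord0); apply/eqP.
move=> g; apply: ES2_ext; last by rewrite crd_endo_map // -E mx_of_endo.
rewrite [RHS]eu1_endo_map Da Db.
have -> : wtilde g = col_mx (const_mx (ew1 g)) (ew g) :> 'cV_(1 + m) by [].
rewrite col_mxKu col_mxKd mxE -/(wtilde g).
(* [ES2_decomp] splits [h g] into its w- and u-contributions, the power of [x1] being killed by
   [h]. *)
have -> : h (MkES2 hp 0 (eu g) 0 0) = - h (MkES2 hp 0 0 (ew1 g) (ew g)) + h g.
  by rewrite [in h g](ES2_decomp g) hM hM hx add0r addKr.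
rewrite [- _ + _ + _]addrAC addNr add0r [i21 _](i21D hp) hE tE -/(q g).
by rewrite subrK [RHS]addrC subrK.
Qed.

End Endomorphisms.

(** * Automorphisms *)

Section Automorphisms.

Variables (p : nat) (hp : prime p) (hodd : odd p) (m : nat).
Notation G := (ES2 hp m).
Notation Z := ('Z([set: G]))%g.
Notation V := 'cV['F_p]_(m.+1 + m.+1).

Lemma AutP (gT : finGroupType) (t : {perm gT}) :
  reflect {morph t : x y / (x * y)%g} (t \in Aut [set: gT]).
Proof.
rewrite inE; apply: (iffP andP) => [[_ /morphicP tM] x y|tM].
  by apply: tM; rewrite inE.
split; first by apply/subsetP.
by apply/morphicP=> x y _ _; apply: tM.
Qed.

Lemma aut_of_inj (gT : finGroupType) (s : gT -> gT) :
    {morph s : x y / (x * y)%g} -> injective s ->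
  exists2 t : {perm gT}, t \in Aut [set: gT] & t =1 s.
Proof.
move=> sM sI; exists (perm sI) => [|x]; last by rewrite permE.
by apply/AutP=> x y; rewrite !permE.
Qed.

Lemma aut_orbitP (gT : finGroupType) (x y : gT) :
  reflect (exists2 t : {perm gT}, t \in Aut [set: gT] & t x = y) (y \in aut_orbit x).
Proof. by apply: (iffP orbitP) => -[t tA <-]; exists t. Qed.

Lemma aut_orbit_eq (gT : finGroupType) (x y : gT) :
  y \in aut_orbit x -> aut_orbit y = aut_orbit x.
Proof. by move/orbit_eqP. Qed.

Lemma aut_orbit_trans (gT : finGroupType) (x y z : gT) :
  y \in aut_orbit x -> z \in aut_orbit y -> z \in aut_orbit x.
Proof. by move/aut_orbit_eq->. Qed.

Lemma aut_orbit_sym (gT : finGroupType) (x y : gT) :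
  (y \in aut_orbit x) = (x \in aut_orbit y).
Proof. exact: orbit_sym. Qed.

Lemma conjg_aut_orbit (gT : finGroupType) (x y : gT) : (x ^ y)%g \in aut_orbit x.
Proof.
have [|t tA tE] := @aut_of_inj gT (conjg^~ y) _ (conjg_inj y).
  by move=> a b; rewrite conjMg.
by apply/aut_orbitP; exists t; rewrite ?tE.
Qed.

(** The square of [Delta] is -1, so [- l^-1 *: (Delta *m S^T *m Delta)] is a left inverse of [S]. *)
Lemma symp_unit (S : 'M['F_p]_(m.+1 + m.+1)) (l : 'F_p) : l != 0 ->
  S^T *m Delta 'F_p m.+1 *m S = l *: Delta 'F_p m.+1 -> S \in unitmx.
Proof.
move=> l0 E; have D2 : Delta 'F_p m.+1 *m Delta 'F_p m.+1 = - 1%:M.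
  rewrite /Delta mulmx_block !mulmx0 !mul0mx !add0r !addr0 mulmxN !mulmx1.
  by rewrite [in RHS]scalar_mx_block opp_block_mx !oppr0.
suff : (- l^-1 *: (Delta 'F_p m.+1 *m (S^T *m Delta 'F_p m.+1))) *m S = 1%:M.
  by case/mulmx1_unit.
rewrite -scalemxAl -mulmxA E -scalemxAr D2 scalerA mulNr mulVf //.
by rewrite scaleN1r opprK.
Qed.

(** [S] gives injectivity modulo the centre, the nonzero multiplier gives it on the centre. *)
Lemma endo_inj (s : G -> G) (S : 'M['F_p]_(m.+1 + m.+1)) :
    {morph s : x y / (x * y)%g} -> S \in unitmx ->
    (forall g, crd (s g) = S *m crd g) -> multiplier s != 0 ->
  injective s.
Proof.
move=> sM Su crds l0 x y E.
have /crd_inj_zc[c Dx] : crd x = crd y.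
  by apply: (can_inj (mulKmx Su)); rewrite -!crds E.
move: E; rewrite Dx sM -[RHS]mulg1 => /mulgI.
rewrite endo_zc // -zc0 => /zc_inj/eqP; rewrite mulf_eq0 (negbTE l0) => /eqP->.
by rewrite zc0 mulg1.
Qed.

Lemma endo_expr_aut (A B C D : 'M['F_p]_m.+1) a alpha beta (s : G -> G) :
    endo_expr A B C D a alpha beta s -> A ord0 ord0 != 0 ->
  exists2 t : {perm G}, t \in Aut [set: G] & t =1 s.
Proof.
move=> sE A00; have sM := endo_expr_morph hodd sE.
case: sE => _ symp [A0 C0] ra sE.
apply: aut_of_inj => //; apply: (endo_inj sM (symp_unit A00 symp)).
  by move=> g; rewrite sE crd_endo_map.
by rewrite /multiplier sE /= redD // red_i21 // addr0 xgen0 /= mulr1 ra.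
Qed.

(** The last hypothesis is the first-row condition of [endo_expr] in vector form. *)
Lemma aut_of_symp (S : 'M['F_p]_(m.+1 + m.+1)) (l : 'F_p) : l != 0 ->
    S^T *m Delta 'F_p m.+1 *m S = l *: Delta 'F_p m.+1 ->
    (forall v : V, (S *m v) (first m) 0 = l * v (first m) 0) ->
  exists2 t : {perm G}, t \in Aut [set: G] & forall g, crd (t g) = S *m crd g.
Proof.
move=> l0 symp S0.
have S0j j : S (first m) j = l * (j == first m)%:R.
  by have := S0 (delta_mx j 0); rewrite -colE !mxE eqxx andbT eq_sym.
have A00 : ulsubmx S ord0 ord0 = l by rewrite !mxE S0j eqxx mulr1.
have A0 j : j != ord0 -> ulsubmx S ord0 j = 0.
  move=> nj; rewrite !mxE S0j (inj_eq (@lshift_inj _ _)) (negbTE nj).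
  by rewrite mulr0.
have C0 j : ursubmx S ord0 j = 0 by rewrite !mxE S0j /first eq_rlshift mulr0.
(* Any lift of [l] and any linear forms give an automorphism over [S]; the least residue and zero
   forms are taken. *)
pose a : 'Z_(p ^ 2) := (l : nat)%:R.
have ra : red a = l by rewrite red_nat // natr_Zp.
have sE : endo_expr (ulsubmx S) (drsubmx S) (ursubmx S) (dlsubmx S) a (mx_form 0)
    (mx_form 0) (endo_map (hp := hp) (ulsubmx S) (drsubmx S) (ursubmx S)
    (dlsubmx S) a (mx_form 0) (mx_form 0)).
  split; rewrite ?submxK ?A00 //.
  by rewrite inE; apply/existsP; exists l; rewrite symp.
have [|t tA tE] := endo_expr_aut sE; first by rewrite A00.
exists t => // g; rewrite tE crd_endo_map ?submxK //.
by rewrite A00.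
Qed.

Lemma sform_self (v : V) : sform v v = 0.
Proof.
have /eqP := sform_anti v v; rewrite -addr_eq0 -mulr2n -mulr_natl mulf_eq0.
by rewrite (negbTE (two_neq0 hp hodd)) => /eqP.
Qed.

(** A transvection preserves the form, so its multiplier is 1; it keeps first coordinates because
    [v] has none. *)
Lemma transvection_aut (v : V) c : v (first m) 0 = 0 ->
  exists2 t : {perm G}, t \in Aut [set: G] &
    forall g, crd (t g) = crd g + (c * sform v (crd g)) *: v.
Proof.
move=> v0; pose S := 1%:M + c *: (v *m (v^T *m Delta 'F_p m.+1)).
have SE x : S *m x = x + (c * sform v x) *: v.
  rewrite mulmxDl mul1mx -scalemxAl -mulmxA [v^T *m _ *m x]mx11_scalar.
  by rewrite mul_mx_scalar scalerA.
have [|||t tA tE] := @aut_of_symp S 1; first exact: oner_neq0.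
- rewrite scale1r; apply: bform_inj => x y; rewrite -bform_mul !SE.
  rewrite bformDl !bformDr !bformZl !bformZr -!/(sform _ _).
  rewrite sform_self (sform_anti x v).
  by move: (sform x y) (sform v x) (sform v y) => *; ring.
- by move=> x; rewrite SE !mxE v0 mulr0 addr0 mul1r.
by exists t => // g; rewrite tE SE.
Qed.

(** The diagonal matrix with blocks [l] and 1 scales the form by [l], so every nonzero multiplier
    occurs. *)
Lemma scaling_aut (l : 'F_p) : l != 0 -> exists2 t : {perm G}, t \in Aut [set: G] &
  crd (t (xgen hp ord0)) = l *: crd (xgen hp ord0).
Proof.
move=> l0; pose S : 'M['F_p]_(m.+1 + m.+1) := block_mx l%:M 0 0 1%:M.
have SE u w : S *m col_mx u w = col_mx (l *: u) w.
  by rewrite mul_block_col !mul0mx addr0 add0r mul1mx mul_scalar_mx.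
have [||t tA tE] := @aut_of_symp S l l0.
- rewrite (symp_blocks l%:M 1%:M 0 0 l); split.
  + by rewrite mulmx0 trmx0 mul0mx.
  + by rewrite trmx0 mul0mx mulmx0.
  + by rewrite tr_scalar_mx mulmx1 mulmx0 add0r.
- by move=> v; rewrite -[v]vsubmxK SE !col_mxEu !mxE.
exists t => //; rewrite tE /crd SE [RHS]scale_col_mx; congr col_mx.
have -> : wtilde (xgen hp (ord0 : 'I_m.+1)) = 0.
  by rewrite xgen0; apply: wtilde_zc hp m 0.
by rewrite scaler0.
Qed.

Lemma sform_neq0_ex (x : G) : x \notin Z -> exists y : G, sform (crd x) (crd y) != 0.
Proof.
move=> nZx; apply/existsP; apply: contraR nZx; rewrite negb_exists => /forallP x0.
apply/centerP; rewrite inE; split=> // y _; rewrite /commute mulgC_sform.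
by have := x0 y; rewrite negbK => /eqP->; rewrite zc0 mulg1.
Qed.

Lemma crd_aut_orbit (x y : G) : x \notin Z -> crd y = crd x -> y \in aut_orbit x.
Proof.
case/sform_neq0_ex=> k xk0 /crd_inj_zc[c ->].
(* Scaled so that the commutator of [x] and [z] is exactly [zc c]. *)
pose z := of_crd hp (c / sform (crd x) (crd k) *: crd k).
suff -> : (x * zc hp m c = x ^ z)%g by apply: conjg_aut_orbit.
by rewrite conjg_sform of_crdK /sform bformZr divfK.
Qed.

Lemma sform0l (v : V) : sform 0 v = 0.
Proof. by rewrite /sform /bform trmx0 !mul0mx mxE. Qed.

Lemma sform_orbit1 (x y : G) : red (eu1 x) = red (eu1 y) ->
  sform (crd x) (crd y) != 0 -> y \in aut_orbit x.
Proof.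
move=> Exy xy0; have nZx : x \notin Z.
  by rewrite mem_center; apply: contra xy0 => /eqP->; rewrite sform0l.
pose v := crd y - crd x.
have v0 : v (first m) 0 = 0 by rewrite mxE [X in _ + X]mxE !crd_first Exy subrr.
(* Pairing [v] with [x] gives minus the pairing of [x] with [y]; this coefficient therefore makes
   the transvection add exactly [v]. An inner automorphism then repairs the central discrepancy. *)
have [t tA tE] := transvection_aut (- (sform (crd x) (crd y))^-1) v0.
have tx : crd (t x) = crd y.
  have -> : crd y = crd x + v by rewrite addrC subrK.
  rewrite tE; congr (_ + _); rewrite /v /sform bformDl bformNl -!/(sform _ _).
  rewrite sform_self subr0.
  by rewrite [sform (crd y) _]sform_anti mulrNN mulVf // scale1r.
apply: (@aut_orbit_trans _ _ (t x)); first by apply/aut_orbitP; exists t.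
apply: crd_aut_orbit => //; rewrite mem_center tx; apply: contra xy0 => /eqP->.
by rewrite sform_anti sform0l oppr0.
Qed.

(* When x and y are orthogonal, pass through x * h. *)
Lemma sform_orbit (x y h : G) : red (eu1 x) = red (eu1 y) -> h \in ES2_H hp m ->
  sform (crd x) (crd h) != 0 -> sform (crd h) (crd y) != 0 -> y \in aut_orbit x.
Proof.
rewrite mem_H => Exy /eqP h0 xh hy.
have [xy0|] := eqVneq (sform (crd x) (crd y)) 0; last exact: sform_orbit1.
have Exh : red (eu1 (x * h)%g) = red (eu1 x).
  by rewrite -!crd_first crdM mxE [in X in _ + X]crd_first h0 addr0.
apply: (@aut_orbit_trans _ _ (x * h)%g).
  apply: sform_orbit1; first by rewrite Exh.
  by rewrite crdM /sform bformDr -!/(sform _ _) sform_self add0r.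
apply: sform_orbit1; first by rewrite Exh.
by rewrite crdM /sform bformDl -!/(sform _ _) xy0 add0r.
Qed.

Lemma sform_ygenr (x : G) i : sform (crd x) (crd (ygen hp i)) = utilde x i 0.
Proof.
rewrite crd_ygen delta_mx_dshift sformE !bform1_dot.
by rewrite dot_deltar [X in _ - X]dot0r subr0.
Qed.

Lemma sform_xgenr (x : G) i : sform (crd x) (crd (xgen hp i)) = - wtilde x i 0.
Proof.
rewrite crd_xgen delta_mx_ushift sformE !bform1_dot.
by rewrite dot_deltar [X in X - _]dot0r sub0r.
Qed.

End Automorphisms.

(** * The layers 1, Z, K, H, G: orbits and endomorphism images *)

Section Subsets.

Variables (p : nat) (hp : prime p) (hodd : odd p) (m : nat).
Notation G := (ES2 hp m).
Notation Z := ('Z([set: G]))%g.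
Notation H := (ES2_H hp m).
Notation K := (ES2_K hp m).
Notation O := (ES2_O hp m).
Notation x1 := (xgen hp (ord0 : 'I_m.+1)).
Notation y1 := (ygen hp (ord0 : 'I_m.+1)).

Lemma utilde_ord0 (x : G) : utilde x ord0 0 = red (eu1 x).
Proof. by rewrite -crd_first /crd col_mxEu. Qed.

Lemma utilde_lift (x : G) i : utilde x (lift ord0 i) 0 = eu x i 0.
Proof. by rewrite /utilde mxE split1 liftK. Qed.

Lemma wtilde_lift (x : G) i : wtilde x (lift ord0 i) 0 = ew x i 0.
Proof. by rewrite /wtilde mxE split1 liftK. Qed.

Lemma ygen0 : y1 = MkES2 hp 0 0 1 0.
Proof. by rewrite /ygen unlift_none. Qed.

Lemma mem_H_crd (x : G) : (x \in H) = (crd x (first m) 0 == 0).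
Proof. by rewrite mem_H crd_first. Qed.

Lemma ygen_H i : ygen hp i \in H.
Proof. by rewrite mem_H_crd crd_ygen mxE /first eq_lrshift. Qed.

Lemma xgen_H i : i != ord0 -> xgen hp i \in H.
Proof.
by rewrite mem_H_crd crd_xgen mxE (inj_eq (@lshift_inj _ _)) eq_sym => /negbTE->.
Qed.

Lemma x1_notH : x1 \notin H.
Proof. by rewrite mem_H_crd crd_x0 mxE !eqxx oner_eq0. Qed.

Lemma mem_K (x : G) : (x \in K) = [&& x \in H, eu x == 0 & ew x == 0].
Proof. by rewrite !inE. Qed.

Lemma mem_O b (x : G) : (x \in O b) = (x \in K) && (ew1 x == b).
Proof. by rewrite !inE; do !case: (_ == _) => //; case: (_ \in _). Qed.

Lemma subKH : K \subset H.
Proof. by apply/subsetP=> x; rewrite mem_K => /andP[]. Qed.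

Lemma mem_center_K (x : G) : (x \in Z) = (x \in K) && (ew1 x == 0).
Proof.
rewrite ES2_centerE !inE.
by do !case: (_ == _) => //; case: (_ \in _).
Qed.

Lemma subZK : Z \subset K.
Proof. by apply/subsetP=> x; rewrite mem_center_K => /andP[]. Qed.

Lemma K_utilde (x : G) : x \in K -> utilde x = 0.
Proof.
rewrite mem_K mem_H => /and3P[/eqP u1 /eqP u0 _].
by rewrite /utilde u1 u0 -[RHS]col_mx0.
Qed.

Lemma K_wtilde (x : G) : x \in K -> wtilde x = ew1 x *: delta_mx ord0 0.
Proof.
rewrite mem_K => /and3P[_ _ /eqP w0]; apply/colP=> i.
case: (unliftP ord0 i) => [j|] ->; first by rewrite wtilde_lift w0 !mxE mulr0.
by rewrite /wtilde [LHS]mxE split1 unlift_none /= !mxE !eqxx mulr1.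
Qed.

Lemma crd_K (x : G) : x \in K -> crd x = ew1 x *: crd y1.
Proof.
move=> Kx; have Ky : y1 \in K by rewrite mem_K ygen_H ygen0 !eqxx.
rewrite /crd (K_utilde Kx) (K_wtilde Kx) (K_utilde Ky) (K_wtilde Ky).
by rewrite [RHS]scale_col_mx scaler0 ygen0 scale1r.
Qed.

(** Modulo the centre [K] is spanned by [y1], which pairs with [g] to its first coordinate. In
    particular [K] is orthogonal to [H]. *)
Lemma sform_K (g x : G) : x \in K ->
  sform (crd g) (crd x) = red (eu1 g) * ew1 x.
Proof.
by move/crd_K->; rewrite /sform bformZr -/(sform _ _) sform_ygenr utilde_ord0 mulrC.
Qed.

(** A nonzero entry of [eu x] or [ew x] is detected by the dual generator, whose index is not
    [ord0]. Hence [K] is all of the orthogonal of [H] inside [H]. *)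
Lemma HK_sform (x : G) : x \in H :\: K ->
  exists2 h, h \in H & sform (crd x) (crd h) != 0.
Proof.
case/setDP=> Hx; rewrite mem_K Hx /= negb_and => /orP[] nz.
  have [i xi0] : exists i, eu x i 0 != 0.
    apply/existsP; apply: contraR nz; rewrite negb_exists => /forallP x0.
    by apply/eqP/colP=> i; rewrite mxE; apply/eqP; have := x0 i; rewrite negbK.
  exists (ygen hp (lift ord0 i)); first exact: ygen_H.
  by rewrite sform_ygenr utilde_lift.
have [i xi0] : exists i, ew x i 0 != 0.
  apply/existsP; apply: contraR nz; rewrite negb_exists => /forallP x0.
  by apply/eqP/colP=> i; rewrite mxE; apply/eqP; have := x0 i; rewrite negbK.
exists (xgen hp (lift ord0 i)); first by rewrite xgen_H.
by rewrite sform_xgenr wtilde_lift oppr_eq0.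
Qed.

Lemma xgen_HK i : i != ord0 -> xgen hp i \in H :\: K.
Proof.
move=> ni; rewrite inE xgen_H // andbT; apply/negP=> Kx.
have := crd_K Kx; move/colP/(_ (lshift _ i)); rewrite crd_xgen crd_ygen !mxE.
by rewrite !eqxx eq_lrshift mulr0 => /eqP; rewrite oner_eq0.
Qed.

Lemma ygen_HK i : i != ord0 -> ygen hp i \in H :\: K.
Proof.
move=> ni; rewrite inE ygen_H // andbT; apply/negP=> Kx.
have := crd_K Kx; move/colP/(_ (rshift _ i)); rewrite !crd_ygen !mxE.
rewrite !eqxx (inj_eq (@rshift_inj _ _)) (negbTE ni) mulr0 => /eqP.
by rewrite oner_eq0.
Qed.

Lemma crd_eq_K (x y : G) : crd x = crd y -> (x \in K) = (y \in K).
Proof.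
case/crd_inj_zc=> c ->; rewrite !mem_K !mem_H_crd crdM crd_zc addr0.
by rewrite ES2_mulE /= !addr0.
Qed.

Lemma crd_eq_O b (x y : G) : crd x = crd y -> (x \in O b) = (y \in O b).
Proof.
move=> E; rewrite !mem_O (crd_eq_K E); congr (_ && _).
by have [c ->] := crd_inj_zc E; rewrite ES2_mulE /= addr0.
Qed.

Section Aut.

Variable t : {perm G}.
Hypothesis tA : t \in Aut [set: G].
Let tM : {morph t : x y / (x * y)%g} := elimT (AutP t) tA.

Lemma aut_multiplier_neq0 : multiplier t != 0.
Proof.
apply/eqP=> l0; have := endo_zc hodd tM 1; rewrite l0 mul0r zc0 -(endo1 tM).
by move/perm_inj; rewrite -zc0 => /zc_inj/eqP; rewrite oner_eq0.
Qed.

Lemma aut_H x : (t x \in H) = (x \in H).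
Proof.
by rewrite !mem_H red_endo // mulf_eq0 (negbTE aut_multiplier_neq0).
Qed.

Lemma aut_K_crd x : x \in K -> crd (t x) = crd x.
Proof.
(* Outside [K], [t x] would pair nontrivially with some [h] in [H], although the preimage of [h]
   lies in [H] and is orthogonal to [x]. *)
move=> Kx; have Hx := subsetP subKH x Kx; have Ktx : t x \in K.
  apply: contraT => nK; have /HK_sform[h Hh] : t x \in H :\: K.
    by rewrite inE nK aut_H.
  rewrite -(permKV t h) sform_endo // sform_anti sform_K //.
  have /eqP-> : red (eu1 (t^-1%g h)) == 0 by rewrite -mem_H -aut_H permKV.
  by rewrite mul0r oppr0 mulr0 eqxx.
(* The pairing of [t x1] with [t x] is the multiplier times [ew1 (t x)] by [sform_K], and the
   multiplier times [ew1 x] by [sform_endo]. *)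
rewrite (crd_K Ktx) (crd_K Kx); congr (_ *: _); apply: (mulfI aut_multiplier_neq0).
rewrite -[in LHS]sform_K // sform_endo // sform_K //.
by rewrite -crd_first crd_x0 mxE !eqxx mul1r.
Qed.

End Aut.

Lemma aut_K (t : {perm G}) x : t \in Aut [set: G] -> (t x \in K) = (x \in K).
Proof.
move=> tA; apply/idP/idP=> [Ktx | Kx]; last by rewrite (crd_eq_K (aut_K_crd tA Kx)).
have tVA : (t^-1)%g \in Aut [set: G] by rewrite groupV.
by rewrite -(permK t x) (crd_eq_K (aut_K_crd tVA Ktx)).
Qed.

Lemma center_zcP (x : G) : reflect (exists c, x = zc hp m c) (x \in Z).
Proof.
apply: (iffP idP) => [|[c ->]]; last exact: zc_center.
by rewrite mem_center => /eqP/crd0_zc.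
Qed.

Lemma endo_x1_center (x : G) : x \in Z :\ 1%g -> exists2 c, c != 0 & x = zc hp m c.
Proof.
case/setD1P=> x0 /center_zcP[c Dx]; exists c => //.
by apply: contraNneq x0 => c0; rewrite Dx c0 zc0.
Qed.

Lemma zc_eq1 c : (zc hp m c == 1%g) = (c == 0).
Proof. by rewrite -zc0 (inj_eq (@zc_inj _ hp m)). Qed.

Lemma aut_orbit_1 : aut_orbit (1%g : G) = [set 1%g].
Proof.
apply/setP=> y; rewrite inE; apply/aut_orbitP/eqP=> [[t /AutP tM <-]|->].
  exact: endo1.
by exists 1%g; rewrite ?group1 ?perm1.
Qed.

Lemma scaling_multiplier (t : {perm G}) l :
  crd (t x1) = l *: crd x1 -> multiplier t = l.
Proof.
by move=> E; rewrite /multiplier -crd_first E mxE crd_x0 mxE !eqxx mulr1.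
Qed.

Lemma aut_orbit_center (x : G) : x \in Z :\ 1%g -> aut_orbit x = Z :\ 1%g.
Proof.
case/endo_x1_center=> c c0 ->; apply/setP=> y; apply/aut_orbitP/idP.
  case=> t tA <-; have /AutP tM := tA.
  rewrite endo_zc // in_setD1 zc_eq1 zc_center andbT.
  by rewrite mulf_neq0 // aut_multiplier_neq0.
case/endo_x1_center=> d d0 ->.
have [|t tA /scaling_multiplier tl] := @scaling_aut _ hp hodd m (d / c).
  by rewrite mulf_neq0 // invr_eq0.
by exists t => //; have /AutP tM := tA; rewrite endo_zc // tl divfK.
Qed.

(** Automorphisms fix elements of [K] modulo the centre, and inner ones fill the whole coset. *)
Lemma aut_orbit_O b (x : G) : b != 0 -> x \in O b -> aut_orbit x = O b.
Proof.
move=> b0 Ox; apply/setP=> y; apply/idP/idP=> [/aut_orbitP[t tA <-]|Oy].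
  rewrite (@crd_eq_O b _ x) //; apply: aut_K_crd => //.
  by move: Ox; rewrite mem_O => /andP[].
move: Ox Oy; rewrite !mem_O => /andP[Kx /eqP xb] /andP[Ky /eqP yb].
apply: crd_aut_orbit => //; last by rewrite (crd_K Kx) (crd_K Ky) xb yb.
by rewrite mem_center_K Kx xb.
Qed.

Lemma aut_orbit_HK (x : G) : x \in H :\: K -> aut_orbit x = H :\: K.
Proof.
move=> HKx; apply/setP=> y; apply/idP/idP=> [/aut_orbitP[t tA <-]|HKy].
  by rewrite inE aut_K // aut_H // -in_setD.
have Exy : red (eu1 x) = red (eu1 y).
  have [+ _] := setDP HKx; have [+ _] := setDP HKy.
  by rewrite !mem_H => /eqP-> /eqP->.
(* [sform_orbit] needs one element of [H] pairing nontrivially with both [x] and [y]: if neither [h]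
   nor [k] serves, [h * k] does. *)
have [h Hh xh] := HK_sform HKx; have [k Hk yk] := HK_sform HKy.
have ky : sform (crd k) (crd y) != 0 by rewrite sform_anti oppr_eq0.
have [hy|] := eqVneq (sform (crd h) (crd y)) 0; last first.
  by move=> hy; exact: (sform_orbit hodd Exy Hh xh hy).
have [xk|xk] := eqVneq (sform (crd x) (crd k)) 0; last first.
  exact: (sform_orbit hodd Exy Hk xk ky).
apply: (@sform_orbit _ _ hodd m x y (h * k)%g Exy).
- move: Hh Hk; rewrite !mem_H_crd crdM => /eqP h0 /eqP k0.
  by rewrite [X in X == _]mxE h0 k0 addr0.
- by rewrite crdM /sform bformDr -!/(sform _ _) xk addr0.
- by rewrite crdM /sform bformDl -!/(sform _ _) hy add0r.
Qed.

(** A scaling first matches the first coordinates; [y1] then serves as the intermediate point, as it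
    pairs nontrivially with everything outside [H]. *)
Lemma x1_aut_orbit (y : G) : y \notin H -> y \in aut_orbit x1.
Proof.
rewrite mem_H => y0; have [t tA tx] := @scaling_aut _ hp hodd m _ y0.
apply: (@aut_orbit_trans _ _ (t x1)); first by apply/aut_orbitP; exists t.
have Et : red (eu1 (t x1)) = red (eu1 y) := scaling_multiplier tx.
apply: (@sform_orbit _ _ hodd m _ _ y1 Et (ygen_H _)).
  by rewrite sform_ygenr utilde_ord0 Et.
by rewrite sform_anti oppr_eq0 sform_ygenr utilde_ord0.
Qed.

Lemma aut_orbit_notH (x : G) : x \notin H -> aut_orbit x = [set: G] :\: H.
Proof.
move=> nHx; rewrite (aut_orbit_eq (x1_aut_orbit nHx)).
apply/setP=> y; rewrite in_setD in_setT andbT.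
apply/idP/idP=> [/aut_orbitP[t tA <-]|]; last exact: x1_aut_orbit.
by rewrite aut_H // x1_notH.
Qed.

Lemma expg_one (g : G) : (g ^+ (1%R : 'F_p))%g = g.
Proof. by rewrite (val_Fp_nat hp 1) modn_small ?expg1 ?prime_gt1. Qed.

(** Since [h ^+ p = 1] for [h] in [H], powers of [h] are additive in exponents from ['F_p]. These
    are the endomorphisms with cyclic image. *)
Lemma power_endo (h : G) (phi : 'cV['F_p]_(m.+1 + m.+1) -> 'F_p) :
    h \in H -> {morph phi : v w / v + w} ->
  exists2 s : {ffun G -> G}, s \in Endo G & forall x, s x = (h ^+ phi (crd x))%g.
Proof.
rewrite mem_H => /eqP h0 phiD.
exists [ffun x => (h ^+ phi (crd x))%g] => [|x]; last by rewrite ffunE.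
have hp1 : (h ^+ p)%g = 1%g by rewrite expg_p // h0 zc0.
have hX k : (h ^+ (k%:R : 'F_p))%g = (h ^+ k)%g.
  by rewrite (val_Fp_nat hp) {2}(divn_eq k p) expgD mulnC expgM hp1 expg1n mul1g.
by apply/EndoP=> x y; rewrite !ffunE -expgD -[RHS]hX natrD !natr_Zp crdM phiD.
Qed.

(** Inside [H] a power endomorphism along the first coordinate works; outside, an automorphism
    does. *)
Lemma endo_x1_any (g : G) : exists2 s : {ffun G -> G}, s \in Endo G & s x1 = g.
Proof.
have [Hg|nHg] := boolP (g \in H).
  have [|s sE sg] := @power_endo g (fun v => v (first m) 0) Hg.
    by move=> v w; rewrite mxE.
  exists s => //; rewrite sg /= crd_x0 mxE !eqxx.
  by rewrite expg_one.
have /aut_orbitP[t /AutP tM tx] := x1_aut_orbit nHg.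
by exists (finfun t); [apply/EndoP=> x y | ]; rewrite !ffunE.
Qed.

Lemma end_imagesP (x y : G) :
  reflect (exists2 s : {ffun G -> G}, s \in Endo G & s x = y) (y \in end_images x).
Proof. by apply: (iffP imsetP) => -[s sE Dy]; exists s. Qed.

Lemma end_images_1 : end_images (1%g : G) = [set 1%g].
Proof.
apply/setP=> y; rewrite inE; apply/end_imagesP/eqP=> [[s /EndoP sM <-]|->].
  exact: endo1.
by have [s sE _] := endo_x1_any 1%g; exists s => //; have /EndoP/endo1 := sE.
Qed.

Lemma end_images_center (x : G) : x \in Z :\ 1%g -> end_images x = Z.
Proof.
case/endo_x1_center=> c c0 ->; apply/setP=> y; apply/end_imagesP/idP.
  by case=> s /EndoP sM <-; rewrite endo_zc // zc_center.
(* Sending [x1] to this power gives multiplier [d / c], which carries [zc c] to [zc d]. *)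
case/center_zcP=> d ->; have [s sE sx] := endo_x1_any (x1 ^+ (d / c)%R)%g.
exists s => //; have /EndoP sM := sE; rewrite endo_zc //.
by rewrite /multiplier sx xgen0X [red _](red_nat hp) natr_Zp divfK.
Qed.

Lemma end_images_H (x : G) : x \in H :\: Z -> end_images x = H.
Proof.
case/setDP=> Hx nZx; apply/setP=> y; apply/end_imagesP/idP.
  by case=> s /EndoP sM <-; apply: endo_H.
move=> Hy; have [k xk] := sform_neq0_ex nZx.
(* Normalized to take the value 1 at [x]. *)
pose phi v := sform v (crd k) / sform (crd x) (crd k).
have [|s sE sx] := @power_endo y phi Hy.
  by move=> v w; rewrite /phi /sform bformDl mulrDl.
by exists s; rewrite // sx /phi divff // expg_one.
Qed.

Lemma end_images_notH (x : G) : x \notin H -> end_images x = [set: G].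
Proof.
move=> nHx; apply/setP=> y; rewrite inE; apply/end_imagesP.
have : x1 \in aut_orbit x by rewrite aut_orbit_sym x1_aut_orbit.
case/aut_orbitP=> t /AutP tM tx; have [s /EndoP sM sx] := endo_x1_any y.
exists [ffun g => s (t g)]; last by rewrite ffunE tx.
by apply/EndoP=> g h; rewrite !ffunE tM sM.
Qed.

End Subsets.

(** * Orbits and cardinalities *)

Section Counting.

Variables (p : nat) (hp : prime p) (hodd : odd p) (m : nat).
Notation G := (ES2 hp m).
Notation Z := ('Z([set: G]))%g.
Notation H := (ES2_H hp m).
Notation K := (ES2_K hp m).
Notation O := (ES2_O hp m).
Notation x1 := (xgen hp (ord0 : 'I_m.+1)).
Notation y1 := (ygen hp (ord0 : 'I_m.+1)).

Lemma card_ES2 : #|[set: G]| = (p ^ (2 * m.+1 + 1))%N.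
Proof.
rewrite cardsT (bij_eq_card (f := @ES2_tuple p hp m)); last first.
  by exists (@tuple_ES2 p hp m) => [|[[[? ?] ?] ?]]; first exact: ES2_tupleK.
rewrite !card_prod !card_mx card_Fp // card_ord Zp_cast ?p2_gt1 // !muln1.
by rewrite -expnD -expnSr -expnD; congr expn; lia.
Qed.

Lemma card_H : #|H| = (p ^ (2 * m.+1))%N.
Proof.
pose f (t : 'F_p * 'cV['F_p]_m * 'F_p * 'cV['F_p]_m) : G :=
  MkES2 hp (i21 t.1.1.1) t.1.1.2 t.1.2 t.2.
have fI : injective f.
  by move=> [[[a b] c] d] [[[a' b'] c'] d'] [/(i21_inj hp) /= -> -> -> ->].
have -> : H = f @: setT.
  apply/setP=> x; rewrite inE; apply/idP/imsetP=> [/(pZ_i21 hp)[c Dc]|[t _ ->]].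
    by exists (c, eu x, ew1 x, ew x) => //; rewrite /f /= -Dc; case: x {Dc}.
  by rewrite mem_pZ // red_i21.
rewrite card_imset // cardsT !card_prod !card_mx card_Fp // !muln1.
by rewrite -expnS -expnSr -expnD; congr expn; lia.
Qed.

Lemma card_K : #|K| = (p ^ 2)%N.
Proof.
pose f (t : 'F_p * 'F_p) : G := MkES2 hp (i21 t.1) 0 t.2 0.
have fI : injective f by move=> [a b] [a' b'] [/(i21_inj hp) /= -> ->].
have -> : K = f @: setT.
  apply/setP=> -[a u b w]; rewrite inE.
  apply/and3P/imsetP=> /= [[/(pZ_i21 hp)[c ->] /eqP-> /eqP->]|[t _ [-> -> _ ->]]].
    by exists (c, b).
  by rewrite mem_pZ // red_i21 // !eqxx.
by rewrite card_imset // cardsT !card_prod card_Fp.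
Qed.

Lemma card_O b : #|O b| = p.
Proof.
pose f c : G := MkES2 hp (i21 c) 0 b 0.
have fI : injective f by move=> a a' [/(i21_inj hp)].
have -> : O b = f @: setT.
  apply/setP=> -[a u b' w]; rewrite inE.
  apply/and4P/imsetP=> /=
    [[/(pZ_i21 hp)[c ->] /eqP-> /eqP-> /eqP->]|[c _ [-> -> -> ->]]].
    by exists c.
  by rewrite mem_pZ // red_i21 // !eqxx.
by rewrite card_imset // cardsT card_Fp.
Qed.

Lemma center_O0 : Z = O 0.
Proof. by apply/setP=> x; rewrite mem_center_K mem_O. Qed.

Lemma card_center : #|Z| = p.
Proof. by rewrite center_O0 card_O. Qed.

Lemma card_center1 : #|Z :\ 1%g| = (p - 1)%N.
Proof. by rewrite cardsD (setIidPr _) ?sub1set ?group1 // cards1 card_center. Qed.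

Lemma card_notH :
  #|[set: G] :\: H| = (p ^ (2 * m.+1 + 1) - p ^ (2 * m.+1))%N.
Proof. by rewrite cardsD setTI card_ES2 card_H. Qed.

Lemma card_HK : #|H :\: K| = (p ^ (2 * m.+1) - p ^ 2)%N.
Proof. by rewrite cardsD (setIidPr (subKH hp m)) card_H card_K. Qed.

(** By [expg_p], [H] consists of the elements killed by p, and every p-th power is itself killed by
    p. *)
Lemma notH_order : [set: G] :\: H = [set g : G | #[g]%g == (p ^ 2)%N].
Proof.
apply/setP=> g; rewrite in_setD in_setT andbT [RHS]inE.
have gp : (g ^+ p == 1)%g = (g \in H) by rewrite expg_p // zc_eq1 mem_H.
have gpp : (#[g]%g %| p ^ 2)%N.
  by rewrite order_dvdn expnS expn1 expgM expg_p // zc_eq1 expg_p //= red_i21.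
rewrite -gp -order_dvdn; apply/idP/eqP=> [|->]; last first.
  by rewrite gtnNdvd ?prime_gt0 // -[ltnLHS]expn1 ltn_exp2l ?prime_gt1.
have /(dvdn_pfactor _ _ hp)[[|[|[|//]]] _ ->] := gpp; rewrite ?dvd1n ?dvdnn //.
Qed.

Definition yb b : G := MkES2 hp 0 0 b 0.

Lemma yb_O b : yb b \in O b.
Proof. by rewrite inE /yb /= mem_pZ // red0 // !eqxx. Qed.

Lemma O_notcenter b (x : G) : b != 0 -> x \in O b -> x \notin Z.
Proof.
by move=> b0; rewrite mem_O mem_center_K => /andP[-> /eqP->].
Qed.

Lemma O_disjoint b c : b != c -> [disjoint O b & O c].
Proof.
move=> nbc; apply/pred0P=> x /=; rewrite !mem_O.
by case: (x \in K) => //=; apply: contraNF nbc => /andP[/eqP-> /eqP->].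
Qed.

Lemma O_HK_disjoint b : [disjoint O b & H :\: K].
Proof.
by apply/pred0P=> x /=; rewrite mem_O in_setD; case: (x \in K); rewrite ?andbF.
Qed.

Lemma O_inj : injective O.
Proof.
move=> b c E; have := yb_O b; rewrite E mem_O => /andP[_ /eqP <-] //.
Qed.

Lemma H_center_decomp :
  H :\: Z = (\bigcup_(b : 'F_p | b != 0) O b) :|: (H :\: K).
Proof.
apply/setP=> x; rewrite in_setU !in_setD mem_center_K; apply/idP/idP.
  case/andP=> nZ Hx; rewrite Hx andbT.
  have [Kx|] := boolP (x \in K); last by rewrite orbT.
  rewrite orbF; apply/bigcupP; exists (ew1 x); last by rewrite mem_O Kx eqxx.
  by move: nZ; rewrite Kx.
case/orP=> [/bigcupP[b b0]|/andP[/negbTE-> ->] //].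
by rewrite mem_O => /andP[Kx /eqP->]; rewrite Kx b0 (subsetP (subKH hp m)).
Qed.

(** For [m = 0] the vectors [eu] and [ew] have no entries. *)
Lemma HK_empty : m = 0%N -> H :\: K = set0.
Proof.
move=> m0; apply/setP=> x; rewrite in_set0 in_setD mem_K; apply/negP.
case/andP=> + Hx; have v0 (v : 'cV['F_p]_m) : v = 0.
  by apply/colP=> -[i lt_im]; exfalso; rewrite m0 in lt_im.
by rewrite Hx [eu x]v0 [ew x]v0 !eqxx.
Qed.

Lemma HK_pos (x : G) : x \in H :\: K -> (0 < m)%N.
Proof. by case: (posnP m) => // /HK_empty->; rewrite in_set0. Qed.

Lemma HK_neq0 : (0 < m)%N -> exists x : G, x \in H :\: K.
Proof.
move=> m0; exists (ygen hp (lift ord0 (Ordinal m0))); exact: ygen_HK.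
Qed.

(** The case split is needed because for n = 1 the set [H :\: K] is empty, hence not an orbit. *)
Definition HK_orbits : {set {set G}} := if (1 < m.+1)%N then [set H :\: K] else set0.

Definition O_orbits : {set {set G}} := [set O b | b : 'F_p & b != 0].

Definition big_orbits : {set {set G}} :=
  [set [set 1%g]; Z :\ 1%g; [set: G] :\: H].

Lemma zc1_center : zc hp m 1 \in Z :\ 1%g.
Proof. by rewrite in_setD1 zc_eq1 oner_eq0 zc_center. Qed.

Lemma aut_orbitsE : aut_orbits G = big_orbits :|: O_orbits :|: HK_orbits.
Proof.
apply/setP=> S; rewrite !in_setU; apply/imsetP/idP=> [[x _ ->]|].
  have [Hx|nHx] := boolP (x \in H); last first.
    by rewrite aut_orbit_notH // in_set1 !inE eqxx !orbT.
  have [Kx|nKx] := boolP (x \in K); last first.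
    have HKx : x \in H :\: K by rewrite in_setD nKx.
    by rewrite aut_orbit_HK // /HK_orbits ltnS (HK_pos HKx) set11 orbT.
  have [b0|b0] := eqVneq (ew1 x) 0; last first.
    have Ox : x \in O (ew1 x) by rewrite mem_O Kx eqxx.
    by rewrite (aut_orbit_O hodd b0 Ox) (imset_f O) ?inE // orbT.
  have Zx : x \in Z by rewrite mem_center_K Kx b0 eqxx.
  have [->|x0] := eqVneq x 1%g; first by rewrite aut_orbit_1 !inE eqxx.
  by rewrite aut_orbit_center ?in_setD1 ?x0 // !inE eqxx !orbT.
rewrite !in_set1 -!orbA.
case/or4P=> [/eqP->|/eqP->|/eqP->|/orP[/imsetP[b b0 ->]|]].
- by exists 1%g; rewrite ?aut_orbit_1.
- by exists (zc hp m 1); rewrite ?(aut_orbit_center hodd zc1_center).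
- by exists x1; rewrite ?aut_orbit_notH ?x1_notH.
- rewrite inE in b0.
  by exists (yb b); rewrite ?(aut_orbit_O hodd b0 (yb_O b)).
rewrite /HK_orbits; case: ifP => [m0|]; last by rewrite in_set0.
have [x HKx] := HK_neq0 m0.
by rewrite in_set1 => /eqP->; exists x; rewrite ?aut_orbit_HK.
Qed.

Lemma card_O_orbits : #|O_orbits| = (p - 1)%N.
Proof.
rewrite card_imset; last exact: O_inj.
have := cardsD1 (0 : 'F_p) setT; rewrite in_setT cardsT card_Fp // => E.
rewrite [in RHS]E addKn; apply: eq_card => b; rewrite !inE andbT //.
Qed.

(** The three sets are told apart by the elements [1] and [zc 1]. *)
Lemma card_big_orbits : #|big_orbits| = 3%N.
Proof.
have Z1H : zc hp m 1 \in H.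
  by rewrite (subsetP (subKH hp m)) // (subsetP (subZK hp m)) // zc_center.
have H1 : 1%g \in H.
  by rewrite (subsetP (subKH hp m)) // (subsetP (subZK hp m)) // group1.
rewrite /big_orbits setUC cardsU1 cards2 in_set2.
have -> : [set 1%g] != Z :\ 1%g :> {set G}.
  by apply/eqP=> /setP/(_ 1%g); rewrite in_setD1 set11 eqxx.
have /negbTE-> : [set: G] :\: H != [set 1%g].
  by apply/eqP=> /setP/(_ 1%g); rewrite in_setD H1 set11.
have /negbTE-> // : [set: G] :\: H != Z :\ 1%g.
by apply/eqP=> /setP/(_ (zc hp m 1)); rewrite in_setD Z1H zc1_center.
Qed.

Lemma big_O_disjoint : [disjoint big_orbits & O_orbits].
Proof.
apply/pred0P=> S /=; apply/negP=> /andP[+ /imsetP[b]]; rewrite inE => + b0 DS.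
rewrite DS /big_orbits 2!in_setU !in_set1 -orbA.
have nZ := O_notcenter b0 (yb_O b).
have Hy : yb b \in H by rewrite mem_H /yb /= red0.
by case/or3P=> /eqP/setP/(_ (yb b)); rewrite yb_O;
  [move/esym/set1P=> E; rewrite E group1 in nZ
  | rewrite in_setD1 (negbTE nZ) andbF | rewrite in_setD Hy].
Qed.

Lemma HK_notin : (0 < m)%N -> H :\: K \notin big_orbits :|: O_orbits.
Proof.
move=> m0; have [x HKx] := HK_neq0 m0.
have [Hx nKx] := setDP HKx.
have nZx : x \notin Z by apply: contra nKx; apply: (subsetP (subZK hp m)).
rewrite /big_orbits !in_setU !in_set1 -!orbA; apply/negP.
case/or4P=> [/eqP/setP/(_ x)|/eqP/setP/(_ x)|/eqP/setP/(_ x)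
            |/imsetP[b _]/setP/(_ x)];
  rewrite HKx.
- by move/esym/set1P=> E; rewrite E group1 in nZx.
- by rewrite in_setD1 (negbTE nZx) andbF.
- by rewrite in_setD Hx.
- by rewrite mem_O (negbTE nKx).
Qed.

(** The count is 3 + (p - 1), plus one when [H :\: K] is nonempty. *)
Lemma card_aut_orbits :
  #|aut_orbits G| = (if (0 < m)%N then p + 3 else p + 2)%N.
Proof.
have p0 := prime_gt0 hp.
have E : #|big_orbits :|: O_orbits| = (p + 2)%N.
  rewrite cardsU (disjoint_setI0 big_O_disjoint) cards0 subn0.
  rewrite card_big_orbits card_O_orbits; lia.
rewrite aut_orbitsE /HK_orbits ltnS; case: ifP => m0; last by rewrite setU0.
by rewrite setUC cardsU1 E HK_notin // addnCA.
Qed.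

Definition H_orbits : {set {set G}} :=
  if (1 < m.+1)%N then (H :\: K) |: O_orbits else O_orbits.

Lemma H_orbitsE : H_orbits = O_orbits :|: HK_orbits.
Proof. by rewrite /H_orbits /HK_orbits; case: ifP; rewrite ?setU0 // setUC. Qed.

Lemma H_orbits_sub : H_orbits \subset aut_orbits G.
Proof. by rewrite H_orbitsE aut_orbitsE -setUA subsetUr. Qed.

Lemma card_H_orbits : #|H_orbits| = if (1 < m.+1)%N then p else (p - 1)%N.
Proof.
rewrite /H_orbits; case: ifP => m0; last exact: card_O_orbits.
have := HK_notin m0; rewrite in_setU negb_or => /andP[_ nO].
by rewrite cardsU1 nO card_O_orbits add1n subn1 prednK ?prime_gt0.
Qed.

Lemma H_orbits_partition : partition H_orbits (H :\: Z).
Proof.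
(* Disjointness and nonemptiness are inherited from the orbit partition of the whole group; only the
   cover is computed. *)
have part : partition (aut_orbits G) [set: G].
  by apply: orbit_partition; apply/actsP=> t _ x; rewrite !in_setT.
have [_ triv] := and3P part => n0.
apply/and3P; split.
- rewrite eqEsubset; apply/andP; split; apply/subsetP=> x.
    case/bigcupP=> S; rewrite H_orbitsE H_center_decomp !in_setU.
    case/orP=> [/imsetP[b b0 ->] Ox|].
      by apply/orP; left; apply/bigcupP; exists b => //; rewrite inE in b0.
    rewrite /HK_orbits; case: ifP => _; last by rewrite in_set0.
    by rewrite in_set1 => /eqP-> ->; rewrite orbT.
  rewrite H_center_decomp H_orbitsE /cover !in_setU => /orP[/bigcupP[b b0 Ox]|HKx].
    by apply/bigcupP; exists (O b) => //; rewrite in_setU (imset_f O) ?inE.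
  apply/bigcupP; exists (H :\: K) => //.
  by rewrite in_setU /HK_orbits ltnS (HK_pos HKx) set11 orbT.
- exact: trivIsetS H_orbits_sub triv.
- by apply: contra n0; apply: (subsetP H_orbits_sub).
Qed.

End Counting.

(** * The commutator form for an arbitrary generator, and the matrices of automorphisms *)

Section Invariants.

Variables (p : nat) (hp : prime p) (hodd : odd p) (m : nat).
Notation G := (ES2 hp m).
Notation Z := ('Z([set: G]))%g.
Notation H := (ES2_H hp m).
Notation K := (ES2_K hp m).
Notation x1 := (xgen hp (ord0 : 'I_m.+1)).
Notation y1 := (ygen hp (ord0 : 'I_m.+1)).

(** Writing the generator as [zc c], the two forms differ by the nonzero factor [c], so scaling
    identities transfer. *)
Lemma symp_form_sform (z : G) : generator Z z ->
  exists2 c : 'F_p, c != 0 & forall x y : G,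
    sform (crd x) (crd y) = c * symp_form p z (coset Z x) (coset Z y).
Proof.
move=> gz; have Zz : z \in Z by rewrite (eqP gz) cycle_id.
have /center_zcP[c Dz] := Zz.
exists c => [|x y]; last first.
  apply: (@zc_inj _ hp m); rewrite -commg_sform (symp_formP x y gz) {1}Dz zcX.
  by rewrite -mulr_natr natr_Zp.
apply/eqP=> c0; have := setD1P (zc1_center hp m) => -[z1 Zz1].
by move: Zz1 z1; rewrite (eqP gz) Dz c0 zc0 cycle1 => /set1P->; rewrite eqxx.
Qed.

Lemma endo_generator (s : G -> G) (z : G) : {morph s : x y / (x * y)%g} ->
  generator Z z -> s z = (z ^+ multiplier s)%g.
Proof.
move=> sM gz; have Zz : z \in Z by rewrite (eqP gz) cycle_id.
have /center_zcP[c ->] := Zz.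
by rewrite endo_zc // zcX -mulr_natl natr_Zp.
Qed.

Lemma endo_symp_form (s : G -> G) (z x y : G) : {morph s : x y / (x * y)%g} ->
    generator Z z ->
  symp_form p z (induced s (coset Z x)) (induced s (coset Z y))
    = multiplier s * symp_form p z (coset Z x) (coset Z y).
Proof.
move=> sM gz; have [c c0 E] := symp_form_sform gz.
apply: (mulfI c0); rewrite !induced_endo // -E sform_endo // E.
by rewrite mulrCA.
Qed.

Lemma red_unit (a : 'Z_(p ^ 2)) : red a != 0 -> a \is a GRing.unit.
Proof.
rewrite -[a in X in _ -> X]natr_Zp unitZpE ?p2_gt1 // coprime_pexpl //.
rewrite prime_coprime // (dvdn_pcharf (pchar_Fp hp)) //.
Qed.

Lemma aut_x1 (t : {perm G}) : t \in Aut [set: G] ->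
  exists2 g, g \in H & t x1 = (x1 ^+ multiplier t * g)%g.
Proof.
move=> /AutP tM; exists ((x1 ^+ multiplier t)^-1 * t x1)%g; last by rewrite mulKVg.
have E : red (eu1 (x1 ^+ multiplier t)%g) = multiplier t.
  by rewrite xgen0X [red _](red_nat hp) natr_Zp.
by rewrite mem_H_crd crdM crdV mxE [X in X + _]mxE !crd_first E addNr.
Qed.

Lemma aut_y1 (t : {perm G}) : t \in Aut [set: G] -> crd (t y1) = crd y1.
Proof. by move=> tA; apply: aut_K_crd => //; rewrite mem_K ygen_H ygen0 !eqxx. Qed.

Lemma aut_orbit_mem (t : {perm G}) (x : G) :
  t \in Aut [set: G] -> t x \in aut_orbit x.
Proof. by move=> tA; apply/aut_orbitP; exists t. Qed.

Lemma aut_expr (t : {perm G}) (A B C D : 'M['F_p]_m.+1) :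
    t \in Aut [set: G] -> mx_of (@induced G t) = block_mx A C D B ->
  (exists a alpha beta,
     [/\ endo_expr A B C D a alpha beta t,
         block_mx A C D B \in Sp_scalar 'F_p m.+1,
         A ord0 ord0 != 0 & a \is a GRing.unit]) /\
  [/\ B ord0 ord0 = 1, (forall i, i != ord0 -> B i ord0 = 0)
    & (forall i, i != ord0 -> C i ord0 = 0)].
Proof.
move=> tA E; have /AutP tM := tA.
have [A00 _ _] := mx_of_blocks hodd tM E.
have A0 : A ord0 ord0 != 0 by rewrite A00 aut_multiplier_neq0.
split.
  have [a [alpha [beta sE]]] := endo_exprP hodd tM E.
  have [_ symp _ ra _] := sE.
  exists a, alpha, beta; split=> //; last by rewrite red_unit // ra.
  rewrite inE (symp_unit A0 symp); apply/existsP; exists (A ord0 ord0).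
  by rewrite A0 symp eqxx.
(* The column of [y1] is that of the identity, because automorphisms fix [y1] modulo the centre. *)
have col1 i : block_mx A C D B i (rshift _ ord0) = (i == rshift _ ord0)%:R.
  have := congr1 (fun v : 'cV_(_ + _) => v i 0) (mx_of_endo hodd tM y1).
  by rewrite E aut_y1 // crd_ygen -colE !mxE eqxx andbT.
split=> [|i ni|i _].
- by have := col1 (rshift _ ord0); rewrite block_mxEdr eqxx.
- have := col1 (rshift _ i); rewrite block_mxEdr => ->.
  by rewrite (inj_eq (@rshift_inj _ _)) (negbTE ni).
- by have := col1 (lshift _ i); rewrite block_mxEur eq_lrshift.
Qed.

(** [y1] and its inverse both have image set [H], but they lie in [O 1] and [O (- 1)], which differ
    because p is odd. *)
Lemma endomorphic_not_automorphic :
  exists x y : G, [/\ endomorphic y x, endomorphic x y & ~ automorphic y x].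
Proof.
have HZ b : b != 0 -> yb hp m b \in H :\: Z.
  move=> b0; rewrite in_setD (O_notcenter b0 (yb_O hp m b)) mem_H /yb /= red0 //.
have N1 : - 1 != 0 :> 'F_p by rewrite oppr_eq0 oner_eq0.
have [H1 HN1] := (HZ 1 (oner_neq0 _), HZ _ N1).
exists (yb hp m 1), (yb hp m (- 1)); split.
- by rewrite /endomorphic end_images_H //; case/setDP: HN1.
- by rewrite /endomorphic end_images_H //; case/setDP: H1.
rewrite /automorphic (aut_orbit_O hodd (oner_neq0 _) (yb_O hp m 1)) mem_O /=.
case/andP=> _; rewrite eq_sym -addr_eq0 -mulr2n => /eqP E.
by have := two_neq0 hp hodd; rewrite E eqxx.
Qed.

End Invariants.

Theorem mainTheorem2 (p m : nat) (hp : prime p) (hodd : odd p) :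
  let n := m.+1 in
  let Z := ('Z([set: ES2 hp m]))%g in
  let H := ES2_H hp m in
  let K := ES2_K hp m in
  let O := ES2_O hp m in
  let x1 := xgen hp (ord0 : 'I_n) in
  let y1 := ygen hp (ord0 : 'I_n) in
  (* (A) *)
  (forall z : ES2 hp m, generator Z z ->
    forall s : {ffun ES2 hp m -> ES2 hp m}, s \in Endo (ES2 hp m) ->
      exists l : 'F_p,
        (forall z' : ES2 hp m, generator Z z' -> s z' = (z' ^+ l)%g) /\
        (forall x y : ES2 hp m,
          symp_form p z (induced s (coset Z x)) (induced s (coset Z y))
            = l * symp_form p z (coset Z x) (coset Z y))) /\
  (forall g : ES2 hp m,
    exists2 s : {ffun ES2 hp m -> ES2 hp m}, s \in Endo (ES2 hp m) &
      s x1 = g) /\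
  (forall s : {ffun ES2 hp m -> ES2 hp m}, s \in Endo (ES2 hp m) ->
    (forall i : 'I_n, i != ord0 -> s (xgen hp i) \in H) /\
    (forall j : 'I_n, s (ygen hp j) \in H)) /\
  (* (B) *)
  (forall s : {ffun ES2 hp m -> ES2 hp m}, s \in Endo (ES2 hp m) ->
    forall A B C D : 'M['F_p]_n,
      mx_of (induced s) = block_mx A C D B ->
      exists (a : 'Z_(p ^ 2)) (alpha : {scalar 'cV['F_p]_m})
             (beta : {scalar 'cV['F_p]_n}),
        endo_expr A B C D a alpha beta s) /\
  (forall (A B C D : 'M['F_p]_n) (a : 'Z_(p ^ 2))
          (alpha : {scalar 'cV['F_p]_m}) (beta : {scalar 'cV['F_p]_n})
          (s : {ffun ES2 hp m -> ES2 hp m}),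
    endo_expr A B C D a alpha beta s -> s \in Endo (ES2 hp m)) /\
  (* (C) *)
  (forall z : ES2 hp m, generator Z z ->
    forall s : {perm ES2 hp m}, s \in Aut [set: ES2 hp m] ->
      exists l : 'F_p,
        [/\ l != 0,
            (forall z' : ES2 hp m, generator Z z' -> s z' = (z' ^+ l)%g),
            (forall x y : ES2 hp m,
              symp_form p z (induced s (coset Z x)) (induced s (coset Z y))
                = l * symp_form p z (coset Z x) (coset Z y))
          & exists2 g, g \in H & s x1 = (x1 ^+ l * g)%g]) /\
  (forall s : {perm ES2 hp m}, s \in Aut [set: ES2 hp m] ->
    (exists2 h, h \in Z & s y1 = (y1 * h)%g) /\
    (forall i : 'I_n, i != ord0 ->
      s (xgen hp i) \in H :\: K /\ s (ygen hp i) \in H :\: K)) /\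
  (* (D) *)
  (forall s : {perm ES2 hp m}, s \in Aut [set: ES2 hp m] ->
    forall A B C D : 'M['F_p]_n,
      mx_of (induced s) = block_mx A C D B ->
      (exists (a : 'Z_(p ^ 2)) (alpha : {scalar 'cV['F_p]_m})
              (beta : {scalar 'cV['F_p]_n}),
        [/\ endo_expr A B C D a alpha beta s,
            block_mx A C D B \in Sp_scalar 'F_p n,
            A ord0 ord0 != 0 & a \is a GRing.unit]) /\
      [/\ B ord0 ord0 = 1,
          (forall i : 'I_n, i != ord0 -> B i ord0 = 0)
        & (forall i : 'I_n, i != ord0 -> C i ord0 = 0)]) /\
  (forall (A B C D : 'M['F_p]_n) (a : 'Z_(p ^ 2))
          (alpha : {scalar 'cV['F_p]_m}) (beta : {scalar 'cV['F_p]_n})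
          (s : ES2 hp m -> ES2 hp m),
    endo_expr A B C D a alpha beta s ->
    block_mx A C D B \in Sp_scalar 'F_p n ->
    A ord0 ord0 != 0 -> a \is a GRing.unit ->
    exists2 t : {perm ES2 hp m}, t \in Aut [set: ES2 hp m] & t =1 s) /\
  (* (E) *)
  (forall g : ES2 hp m,
    [/\ g = 1%g -> end_images g = [set 1%g] /\ #|end_images g| = 1%N,
        g \in Z :\ 1%g -> end_images g = Z /\ #|end_images g| = p,
        g \in H :\: Z -> end_images g = H /\ #|end_images g| = (p ^ (2 * n))%N
      & g \in [set: ES2 hp m] :\: H ->
        end_images g = [set: ES2 hp m] /\
        #|end_images g| = (p ^ (2 * n + 1))%N]) /\
  (* (F) *)
  ((n = 1%N -> #|aut_orbits (ES2 hp m)| = (p + 2)%N) /\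
   ((1 < n)%N -> #|aut_orbits (ES2 hp m)| = (p + 3)%N) /\
   aut_orbits (ES2 hp m) =
     [set [set 1%g]; Z :\ 1%g; [set: ES2 hp m] :\: H]
       :|: [set O b | b : 'F_p & b != 0]
       :|: (if (1 < n)%N then [set H :\: K] else set0) /\
   #|[set 1%g : ES2 hp m]| = 1%N /\
   #|Z :\ 1%g| = (p - 1)%N /\
   (forall b : 'F_p, b != 0 -> #|O b| = p) /\
   [set: ES2 hp m] :\: H = [set g : ES2 hp m | #[g]%g == (p ^ 2)%N] /\
   #|[set: ES2 hp m] :\: H| = (p ^ (2 * n + 1) - p ^ (2 * n))%N /\
   ((1 < n)%N -> #|H :\: K| = (p ^ (2 * n) - p ^ 2)%N)) /\
  (* (G) *)
  (exists x y : ES2 hp m,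
    [/\ endomorphic y x, endomorphic x y & ~ automorphic y x]) /\
  ~ End_induces_order (ES2 hp m) /\
  (H :\: Z = (\bigcup_(b : 'F_p | b != 0) O b) :|: (H :\: K) /\
   (forall b c : 'F_p, b != c -> [disjoint O b & O c]) /\
   (forall b : 'F_p, [disjoint O b & H :\: K]) /\
   (* H :\: K is empty for n = 1. *)
   (let P := [set O b | b : 'F_p & b != 0] in
    let Q := if (1 < n)%N then (H :\: K) |: P else P in
    [/\ partition Q (H :\: Z), Q \subset aut_orbits (ES2 hp m)
      & #|Q| = if (1 < n)%N then p else (p - 1)%N])).
Proof.
move=> n Z H K O x1 y1.
have autM (t : {perm ES2 hp m}) : t \in Aut [set: ES2 hp m] ->
  {morph t : x y / (x * y)%g} by move/AutP.
split.
  move=> z gz s /EndoP sM; exists (multiplier s); split=> [z' gz'|x y].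
    exact: endo_generator.
  exact: endo_symp_form.
split; first exact: endo_x1_any.
split.
  move=> s /EndoP sM; split=> [i ni|j]; apply: endo_H => //.
    exact: xgen_H.
  exact: ygen_H.
split; first by move=> s /EndoP sM A B C D E; apply: endo_exprP.
split; first by move=> A B C D a alpha beta s sE; apply/EndoP; apply: endo_expr_morph sE.
split.
  move=> z gz s sA; have sM := autM s sA; exists (multiplier s).
  split; [exact: aut_multiplier_neq0 | move=> z' | move=> x y | exact: aut_x1].
    exact: endo_generator.
  exact: endo_symp_form.
split.
  move=> s sA; split.
    have [c Dc] := crd_inj_zc (aut_y1 hodd sA).
    by exists (zc hp m c); first exact: zc_center.
  move=> i ni; split.
    (* [H :\: K] is the orbit of the generator itself. *)
    rewrite -(aut_orbit_HK hodd (xgen_HK hp ni)); exact: aut_orbit_mem.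
  rewrite -(aut_orbit_HK hodd (ygen_HK hp ni)); exact: aut_orbit_mem.
split; first by move=> s sA A B C D E; apply: aut_expr.
split.
  by move=> A B C D a alpha beta s sE _ A0 _; apply: endo_expr_aut sE A0.
split.
  move=> g; split.
  - by move=> ->; rewrite end_images_1 // cards1.
  - by move=> Zg; rewrite end_images_center // card_center.
  - by move=> Hg; rewrite end_images_H // card_H.
  - by case/setDP=> _ nHg; rewrite end_images_notH // card_ES2.
split.
  split; first by case=> m0; rewrite card_aut_orbits // m0.
  split; first by rewrite ltnS => m0; rewrite card_aut_orbits // m0.
  split; first exact: aut_orbitsE.
  split; first exact: cards1.
  split; first exact: card_center1.
  split; first by move=> b _; apply: card_O.
  split; first exact: notH_order.
  split; first exact: card_notH.
  by move=> _; apply: card_HK.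
split; first exact: endomorphic_not_automorphic.
split.
  move=> ord; have [x [y [yx xy]]] := endomorphic_not_automorphic hp hodd m.
  by case; apply: ord.
split; first exact: H_center_decomp.
split; first by move=> b c; apply: O_disjoint.
split; first by move=> b; apply: O_HK_disjoint.
move=> P Q; split.
- exact: H_orbits_partition.
- exact: H_orbits_sub.
- exact: card_H_orbits.
Qed.
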